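(* Let $A:X\to Y$ be a bounded linear operator between Hilbert spaces, and let $y\in Y$. Let $\mu\in]-1/2,0[\,\cup\,]0,+\infty[$ and $\delta\in]0,+\infty[$. Then $f(x)=\frac12\|Ax-y\|^2$ is $p$-Łojasiewicz on the source set $\Omega=X_{\mu,\delta}$, with $$p=2+\mu^{-1}\quad\text{and}\quad c_{f,\Omega}=2^{-(\mu+1)/(2\mu+1)}\,\delta^{1/(1+2\mu)}.$$ Moreover, these two constants are sharp.
   Context: Let $y^\dagger$ be the orthogonal projection of $y$ onto $\operatorname{cl} R(A)$, where $R(A)$ is the range of $A$. For $\nu,\delta\in]0,+\infty[$, the data source set is $Y_{\nu,\delta}:=y^\dagger+\{(AA^* )^\nu\omega:\omega\in\operatorname{cl} R(A),\ \|\omega\|\le\delta\}$, where $(AA^* )^\nu$ is the power of the positive selfadjoint operator $AA^*$. For $\mu\in]-1/2,+\infty[$ and $\delta\in]0,+\infty[$, the source set is the preimage $X_{\mu,\delta}:=A^{-1}Y_{\mu+1/2,\delta}$. For the differentiable convex function $f$, and $p\in[1,+\infty[$ (when $\operatorname{argmin} f\neq\emptyset$) or $p\in]-\infty,0[$ (when $f$ is only bounded from below), $f$ is called $p$-Łojasiewicz on $\Omega\subset X$ if there exists a constant $c_{f,\Omega}>0$ such that $(f(x)-\inf f)^{1-1/p}\le c_{f,\Omega}\|\nabla f(x)\|$ for all $x\in\Omega\setminus\operatorname{argmin} f$. (For $\mu\in]-1/2,0[$ one has $p=2+\mu^{-1}<0$; if $\mu>0$ and $\operatorname{argmin} f=\emptyset$,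 then $X_{\mu,\delta}$ is empty and the inequality is vacuous.)
   Formalization: Sharpness is proved when Ω is not contained in argmin f; sharpness of p (no admissible p' with smaller 1−1/p') also assumes R(A) is not closed, since for closed range f is 2-Łojasiewicz everywhere and p can be improved (e.g. A = identity on the real line). *)

(* Defs.v *)
From HB Require Import structures.
From mathcomp Require Import all_boot all_order all_algebra.
From mathcomp Require Import all_classical all_reals all_analysis.

Set Implicit Arguments.
Unset Strict Implicit.
Unset Printing Implicit Defensive.

Import Order.TTheory GRing.Theory Num.Theory.
Import numFieldNormedType.Exports.

Local Open Scope classical_set_scope.
Local Open Scope ring_scope.

(* Real Hilbert spaces: complete normed spaces whose norm comes from an inner
   product; positive definiteness of [inner] is inherited from the norm. *)
HB.mixin Record CompleteNormedModule_isHilbert (R : realType) V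
    of CompleteNormedModule R V := {
  inner : V -> V -> R ;
  innerC : forall x y, inner x y = inner y x ;
  innerDl : forall x y z, inner (x + y) z = inner x z + inner y z ;
  innerZl : forall (a : R) x y, inner (a *: x) y = a * inner x y ;
  inner_norm : forall x, inner x x = `|x| ^+ 2
}.

#[short(type="hilbertType")]
HB.structure Definition Hilbert (R : realType) :=
  { V of CompleteNormedModule_isHilbert R V & CompleteNormedModule R V }.

(* [get P] is the element satisfying [P] whenever there is one. It is used below
   only for notions that exist and are unique in the intended situation (Riesz
   representation, projection onto a closed subspace, functional calculus). *)

Definition adjoint (R : realType) (X Y : hilbertType R) (A : X -> Y) : Y -> X :=
  get [set B : Y -> X | forall x y, inner (A x) y = inner x (B y)].

Definition orth_proj (R : realType) (Y : hilbertType R) (F : set Y) (y : Y) : Y :=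
  get [set z | F z /\ forall v, F v -> inner (y - z) v = 0].

Definition gradient (R : realType) (X : hilbertType R) (f : X -> R^o) (x : X) : X :=
  get [set g | differentiable f x /\ forall h, 'd f x h = inner g h].

Definition opnorm (R : realType) (X Y : hilbertType R) (T : X -> Y) : R :=
  sup [set `|T x| | x in [set x | `|x| <= 1]].

Definition horner_op (R : realType) (Y : hilbertType R) (p : {poly R})
    (T : Y -> Y) (w : Y) : Y :=
  \sum_(i < size p) p`_i *: iter i T w.

(* Continuous functional calculus for a bounded positive selfadjoint T, whose
   spectrum lies in [0, opnorm T]: if polynomials p_n converge to g uniformly on
   that interval, then g(T) is the limit of p_n(T) in operator norm (for linear
   maps: uniformly on the unit ball). *)
Definition fun_calculus (R : realType) (Y : hilbertType R) (g : R -> R)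
    (T : Y -> Y) : Y -> Y :=
  get [set S : Y -> Y | linear S /\ exists p : nat -> {poly R},
    {uniform `[0, opnorm T], (fun n t => (p n).[t]) @ \oo --> g} /\
    {uniform [set w : Y | `|w| <= 1],
       (fun n => horner_op (p n) T) @ \oo --> S}].

Definition op_power (R : realType) (Y : hilbertType R) (T : Y -> Y) (nu : R) :
    Y -> Y :=
  fun_calculus (fun t => t `^ nu) T.

Definition data_proj (R : realType) (X Y : hilbertType R) (A : X -> Y) (y : Y) :
    Y :=
  orth_proj (closure (range A)) y.

Definition data_source_set (R : realType) (X Y : hilbertType R) (A : X -> Y)
    (y : Y) (nu delta : R) : set Y :=
  [set data_proj A y + op_power (A \o adjoint A) nu w |
     w in [set w | closure (range A) w /\ `|w| <= delta]].

Definition source_set (R : realType) (X Y : hilbertType R) (A : X -> Y)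
    (y : Y) (mu delta : R) : set X :=
  A @^-1` data_source_set A y (mu + 2^-1) delta.

Definition argmin (X : Type) (R : realType) (f : X -> R) : set X :=
  [set x | forall z, f x <= f z].

Definition lojasiewicz_exponent (X : Type) (R : realType) (f : X -> R) (p : R) :
    Prop :=
  (1 <= p /\ argmin f !=set0) \/ (p < 0 /\ has_lbound (range f)).

(* [f] satisfies the p-Lojasiewicz inequality on [Omega] with constant [c]. *)
Definition lojasiewicz_with (R : realType) (X : hilbertType R) (f : X -> R)
    (p : R) (Omega : set X) (c : R) : Prop :=
  0 < c /\ forall x, (Omega `\` argmin f) x ->
    (f x - inf (range f)) `^ (1 - p^-1) <= c * `|gradient f x|.

Definition lojasiewicz (R : realType) (X : hilbertType R) (f : X -> R)
    (p : R) (Omega : set X) : Prop :=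
  lojasiewicz_exponent f p /\ exists c, lojasiewicz_with f p Omega c.

Definition least_squares (R : realType) (X Y : hilbertType R) (A : X -> Y)
    (y : Y) (x : X) : R :=
  2^-1 * `|A x - y| ^+ 2.

(* Main.v *)
From HB Require Import structures.
Require Import Defs.
From mathcomp Require Import all_boot all_order all_algebra.
From mathcomp Require Import all_classical all_reals all_analysis.
From mathcomp Require Import zify ring lra.
Import Order.TTheory GRing.Theory Num.Theory.
Import numFieldNormedType.Exports.
Local Open Scope classical_set_scope.
Local Open Scope ring_scope.

(** Write T for the positive selfadjoint operator A o adjoint A, nu for
mu + 1/2, S for T to the power nu, and yd for the projection of y onto the
closure of the range of A.  If A x = yd + S w, then f x - inf f is half the
squared norm of S w and the gradient of f at x is the adjoint of A applied to
S w, whose squared norm is the inner product of T (S w) and S w.  So the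
inequality compares two moments, of orders 2 nu and 2 nu + 1, of the spectral
measure of w, whose total mass is the squared norm of w; it is the
interpolation inequality between the moments of orders 0, 2 nu and 2 nu + 1
([power_interpolation], [op_power_lojasiewicz]).

No spectral measure is constructed.  Its only use would be to turn a pointwise
inequality between functions on [0, m] into an inequality between quadratic
forms, and polynomials suffice for that: a polynomial that is nonnegative on
[0, m] is, up to an arbitrarily small error, a combination of the Bernstein
products 'X^i * (m - 'X)^j with nonnegative coefficients
([bernstein_positive]), and these products give nonnegative forms because
0 <= T <= m ([horner_op_ge0]).  This positivity bounds the norm of p(T) by the
maximum of |p|, hence makes the polynomial approximations of a continuous
function converge in operator norm ([op_approx_exists]), and it passes to the
limit: an affine combination of g^2, t g^2, 1 and t that is nonnegative on the
spectrum gives a nonnegative quadratic form ([op_approx_ge0]).  Every spectral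
estimate of this file is an instance of the latter lemma.

Sharpness.  Equality in the interpolation holds at eigenvectors of norm delta.
Eigenvectors need not exist, but on the range of an operator Q that commutes
with T the supremum m of the Rayleigh quotient is almost attained, and vectors
that almost attain it behave like eigenvectors for the eigenvalue m
([near_eigenvector], [power_le], [power_ge]).  They need not belong to the
source set: the admissible w satisfy yd + S w \in range A.  This set of w is
stable under adding elements of the range of T, which is dense in the closure
of the range of A, so an inequality that holds for all admissible w holds by
continuity on the whole ball ([source_inequality_closure]).  With Q = T the
powers of m cancel and the constant c comes out.  If the range of A is not
closed, then Q can be a cutoff of T near 0, so that m can be made arbitrarily
small ([small_spectrum]); comparing the powers of m gives the sharpness of the
exponent. *)

Set Implicit Arguments.
Unset Strict Implicit.
Unset Printing Implicit Defensive.

(** * Inner products *)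

Lemma eq_imply_le {R : numDomainType} (a b : R) : a = b -> a <= b.
Proof. by move=> ->. Qed.

Section Hilbert.
Context {R : realType} {H : hilbertType R}.
Implicit Types (x y z : H) (a : R).

Lemma innerDr x y z : inner x (y + z) = inner x y + inner x z.
Proof. by rewrite innerC innerDl !(innerC x). Qed.

Lemma innerZr a x y : inner x (a *: y) = a * inner x y.
Proof. by rewrite innerC innerZl innerC. Qed.

Lemma inner0l x : inner 0 x = 0.
Proof. by rewrite -(scale0r (0 : H)) innerZl mul0r. Qed.

Lemma inner0r x : inner x 0 = 0.
Proof. by rewrite innerC inner0l. Qed.

Lemma innerNl x y : inner (- x) y = - inner x y.
Proof. by rewrite -scaleN1r innerZl mulN1r. Qed.

Lemma innerNr x y : inner x (- y) = - inner x y.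
Proof. by rewrite innerC innerNl innerC. Qed.

Lemma innerBl x y z : inner (x - y) z = inner x z - inner y z.
Proof. by rewrite innerDl innerNl. Qed.

Lemma innerBr x y z : inner x (y - z) = inner x y - inner x z.
Proof. by rewrite innerDr innerNr. Qed.

Lemma inner_eq0 x : (forall y, inner x y = 0) -> x = 0.
Proof.
move=> /(_ x); rewrite inner_norm => /eqP.
by rewrite expf_eq0 normr_eq0 /= => /eqP.
Qed.

Lemma inner_inj x y : (forall z, inner x z = inner y z) -> x = y.
Proof.
by move=> xy; apply/subr0_eq/inner_eq0 => z; rewrite innerBl xy subrr.
Qed.

Lemma sqr_normD x y : `|x + y| ^+ 2 = `|x| ^+ 2 + 2 * inner x y + `|y| ^+ 2.
Proof. by rewrite -!inner_norm innerDl !innerDr (innerC y x); ring. Qed.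

Lemma sqr_normB x y : `|x - y| ^+ 2 = `|x| ^+ 2 - 2 * inner x y + `|y| ^+ 2.
Proof. by rewrite sqr_normD innerNr normrN; ring. Qed.

Lemma cauchy_schwarz x y : `|inner x y| <= `|x| * `|y|.
Proof.
have [->|x0] := eqVneq x 0; first by rewrite inner0l !normr0 mul0r.
rewrite -ler_sqr ?nnegrE// ?mulr_ge0//.
have xp : 0 < inner x x by rewrite inner_norm exprn_gt0 // normr_gt0.
pose z := inner x x *: y - inner x y *: x.
have : 0 <= inner x x * (inner x x * inner y y - inner x y ^+ 2).
  have -> : inner x x * (inner x x * inner y y - inner x y ^+ 2) = inner z z.
    by rewrite /z innerBl !innerBr !innerZl !innerZr (innerC y x); ring.
  by rewrite inner_norm exprn_ge0.
by rewrite pmulr_rge0 // subr_ge0 exprMn real_normK ?num_real // -!inner_norm.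
Qed.

Lemma ler_inner x y : inner x y <= `|x| * `|y|.
Proof. exact: le_trans (ler_norm _) (cauchy_schwarz x y). Qed.

Lemma closure_approx (F : set H) x :
  closure F x <-> forall e, 0 < e -> exists2 z, F z & `|x - z| < e.
Proof.
split=> [Fx e e0|Fx B].
  have [z [Fz]] := Fx (ball x e) (nbhsx_ballx x e e0).
  by rewrite -ball_normE /= => xz; exists z.
move=> /nbhs_ballP[e /= e0 eB]; have [z Fz xz] := Fx _ e0.
by exists z; split => //; apply: eB; rewrite -ball_normE.
Qed.

Lemma inner_closure0 (F : set H) x :
  (forall v, F v -> inner x v = 0) -> forall v, closure F v -> inner x v = 0.
Proof.
move=> xF v /closure_approx Fv; apply/eqP; rewrite -normr_le0.
apply/ler_addgt0Pr => e e0; rewrite add0r.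
have [z Fz vz] := Fv (e / (`|x| + 1)) (divr_gt0 e0 (ltr_wpDl (normr_ge0 x) ltr01)).
rewrite -(subrK z v) innerDr (xF _ Fz) addr0.
apply: le_trans (cauchy_schwarz _ _) _.
apply: le_trans (_ : (`|x| + 1) * (e / (`|x| + 1)) <= _).
  by apply: ler_pM => //; [rewrite lerDl|exact: ltW].
by rewrite mulrC divfK // gt_eqF // ltr_wpDl.
Qed.

(** The shape in which the two completeness arguments below, for minimizing
sequences and for polynomial approximations, obtain their Cauchy estimates. *)
Lemma cauchy_harmonic_cvg (u : nat -> H) (C : R) : 0 <= C ->
  (forall m n, `|u m - u n| ^+ 2 <= C * (m.+1%:R^-1 + n.+1%:R^-1)) ->
  exists x, u @ \oo --> x.
Proof.
move=> C0 hu; apply/cvg_ex/cauchy_cvgP/cauchy_exP => e e0.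
have e2 : 0 < e ^+ 2 / (2 * (C + 1)).
  by rewrite divr_gt0 ?exprn_gt0// mulr_gt0// ltr_wpDl.
have [N _ Ne] := near_infty_natSinv_lt (PosNum e2).
exists (u N), N => // n /= /Ne /= ne; rewrite -ball_normE /=.
have {Ne} := Ne N (leqnn N) => /= Ne.
rewrite -ltr_sqr ?nnegrE ?(ltW e0)//.
apply: le_lt_trans (hu _ _) _.
apply: le_lt_trans (_ : (C + 1) * (N.+1%:R^-1 + n.+1%:R^-1) < _).
  by rewrite ler_wpM2r ?addr_ge0 // lerDl.
rewrite -ltr_pdivlMl ?ltr_wpDl//; apply: lt_le_trans (ltrD Ne ne) _.
apply: eq_imply_le; field.
by rewrite gt_eqF // ltr_wpDl.
Qed.
End Hilbert.

(** * Riesz representation, adjoints and projections *)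

(** The vector x is the limit of [B v_n] for a minimizing sequence v_n of the
functional |B v|^2 - 2 l v: the parallelogram identity makes [B v_n] a Cauchy
sequence, and optimality along the lines v_n + t h forces <x, B h> = l h in the
limit.  Taking [B := idfun], [B := A] or [B := adjoint A] gives respectively the
adjoint, the projection onto the closed range, and the range criterion
[douglas_range]. *)
Lemma riesz_range {R : realType} {V : lmodType R} {H : hilbertType R}
    (B : {linear V -> H}) (l : V -> R) (K : R) :
  scalar l -> (forall v, `|l v| <= K * `|B v|) ->
  exists2 x, closure (range B) x & forall v, inner x (B v) = l v.
Proof.
move=> lin_l lK.
have lD u v : l (u + v) = l u + l v by rewrite -[u]scale1r lin_l mul1r scale1r.
have l0 : l 0 = 0 by apply: (addrI (l 0)); rewrite -lD !addr0.
have lZ a v : l (a *: v) = a * l v by rewrite -[a *: v]addr0 lin_l l0 addr0.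
have BD u v : B (u + v) = B u + B v by exact: linearD.
have BZ a v : B (a *: v) = a *: B v by exact: linearZZ.
pose J v := `|B v| ^+ 2 - 2 * l v.
have JK v : - K ^+ 2 <= J v.
  have := lK v; have := ler_norm (l v); rewrite /J => h1 h2.
  have : 0 <= (`|B v| - K) ^+ 2 by exact: sqr_ge0.
  nra.
have hJ : has_inf (range J).
  by split; [exists (J 0), 0|exists (- K ^+ 2) => _ [v _ <-]].
set j := inf (range J).
have jJ v : j <= J v by apply: ge_inf; [exact: hJ.2|exists v].
have /choice[v Jv] n : exists v, J v <= j + n.+1%:R^-1.
  have n0 : 0 < n.+1%:R^-1 :> R by rewrite invr_gt0.
  have [_ [v _ <-] /ltW Jv] := inf_adherent n0 hJ.
  by exists v.
(* the parallelogram identity at the midpoint of v m and v n *)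
have Bcauchy m n : `|B (v m) - B (v n)| ^+ 2 <= 2 * (m.+1%:R^-1 + n.+1%:R^-1).
  have := jJ (2^-1 *: (v m + v n)); have := Jv m; have := Jv n.
  rewrite /J lZ lD BZ BD normrZ exprMn sqr_normD sqr_normB.
  rewrite ger0_norm ?invr_ge0 //.
  set a := `|B (v m)| ^+ 2; set b := `|B (v n)| ^+ 2; set c := inner _ _.
  rewrite expr2; move: (m.+1%:R^-1) (n.+1%:R^-1) => r s.
  by lra.
have [x vx] := cauchy_harmonic_cvg (ler0n R 2) Bcauchy.
have vx_approx e : 0 < e -> exists n, `|x - B (v n)| < e /\ n.+1%:R^-1 < e ^+ 2.
  move=> e0.
  have h1 : \forall n \near \oo, `|x - B (v n)| < e.
    by move/cvgr_dist_lt : vx; apply.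
  have h2 : \forall n \near \oo, n.+1%:R^-1 < e ^+ 2.
    by apply: (near_infty_natSinv_lt (PosNum (exprn_gt0 2 e0))).
  by have [n] := filter_ex (filterI h1 h2); exists n.
exists x.
  by apply/closure_approx => e /vx_approx[n [xn _]]; exists (B (v n)).
move=> h; apply/eqP; rewrite -subr_eq0 -normr_le0; apply/ler_addgt0Pr => e e0.
rewrite add0r.
have k0 : 0 < 2 * (`|B h| + 1) by rewrite mulr_gt0// ltr_wpDl.
have [n [xn nd]] := vx_approx (e / (2 * (`|B h| + 1))) (divr_gt0 e0 k0).
set d := e / _ in xn nd.
have d0 : 0 < d by exact: divr_gt0.
have de : e = d * (2 * (`|B h| + 1)) by rewrite /d divfK // gt_eqF.
(* v n minimizes J up to d ^+ 2 on the line of direction h *)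
have opt t : 0 <= d ^+ 2 + 2 * t * (inner (B (v n)) (B h) - l h) +
    t ^+ 2 * `|B h| ^+ 2.
  have := jJ (v n + t *: h); have := Jv n.
  rewrite /J lD lZ BD BZ sqr_normD innerZr normrZ exprMn.
  by rewrite real_normK ?num_real //; move: n.+1%:R^-1 (d ^+ 2) nd => r d2 nd; lra.
have q : `|inner (B (v n)) (B h) - l h| <= d * `|B h|.
  have [Bh0|Bh0] := eqVneq `|B h| 0.
    have := lK h; rewrite Bh0 mulr0 normr_le0 => /eqP ->.
    move/eqP: Bh0; rewrite normr_eq0 => /eqP ->.
    by rewrite inner0r subrr normr0 mulr0.
  have dB : 0 <= d * `|B h| by apply: mulr_ge0 => //; exact: ltW.
  rewrite -ler_sqr ?nnegrE// real_normK ?num_real//.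
  set D := inner _ _ - _ in opt *.
  have := opt (- D / `|B h| ^+ 2).
  set b := `|B h| in Bh0 *.
  have -> : d ^+ 2 + 2 * (- D / b ^+ 2) * D + (- D / b ^+ 2) ^+ 2 * b ^+ 2 =
    d ^+ 2 - D ^+ 2 / b ^+ 2 by field.
  by rewrite subr_ge0 ler_pdivrMr ?exprMn// exprn_gt0// lt_def Bh0 /b normr_ge0.
have -> : inner x (B h) - l h =
    inner (x - B (v n)) (B h) + (inner (B (v n)) (B h) - l h).
  by rewrite innerBl; ring.
apply: le_trans (ler_normD _ _) _.
apply: le_trans (lerD (cauchy_schwarz _ _) q) _.
have := ler_wpM2r (normr_ge0 (B h)) (ltW xn); clearbody d; lra.
Qed.

Lemma continuous_linear_le {R : realType} {X Y : normedModType R}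
    (A : {linear X -> Y}) : continuous A ->
  exists2 K, 0 < K & forall x, `|A x| <= K * `|x|.
Proof.
move=> cA; have /linear_boundedP := continuous_linear_bounded 0 (cA 0).
move=> [K [_ AK]]; have K1 : 0 < Num.max K 0 + 1.
  by rewrite ltr_wpDl // le_max lexx orbT.
by exists (Num.max K 0 + 1) => //; apply: AK; rewrite ltr_pwDr // le_max lexx.
Qed.

Lemma scalar_inner {R : realType} {V : lmodType R} {H : hilbertType R}
    (B : {linear V -> H}) (y : H) : scalar (fun v => inner y (B v)).
Proof. by move=> a u v; rewrite linearP innerDr innerZr. Qed.

Section Adjoint.
Context {R : realType} {X Y : hilbertType R} (A : {linear X -> Y}).
Hypothesis cA : continuous A.

Lemma adjointP x y : inner (A x) y = inner x (adjoint A y).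
Proof.
have [K K0 AK] := continuous_linear_le cA.
have /choice[B AB] z : exists b, forall x, inner (A x) z = inner x b.
  have zK x' : `|inner z (A x')| <= (`|z| * K) * `|x'|.
    apply: le_trans (cauchy_schwarz _ _) _.
    by rewrite -mulrA ler_wpM2l.
  have [b _ Ab] := riesz_range (B := idfun) (scalar_inner A z) zK.
  by exists b => x'; rewrite innerC -Ab innerC.
pose P := [set B : Y -> X | forall x y, inner (A x) y = inner x (B y)].
by have /(_ x y) := @getPex _ P (ex_intro _ B (fun x y => AB y x)).
Qed.

Lemma adjoint_linear : linear (adjoint A).
Proof.
move=> a u v; apply: inner_inj => x; rewrite !(innerC _ x) innerDr innerZr.
by rewrite -!adjointP innerDr innerZr.
Qed.

Lemma norm_adjoint_le K : 0 < K -> (forall x, `|A x| <= K * `|x|) ->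
  forall y, `|adjoint A y| <= K * `|y|.
Proof.
move=> K0 AK y; have [->|z0] := eqVneq (adjoint A y) 0.
  by rewrite normr0 mulr_ge0 // ltW.
rewrite -(ler_pM2l (_ : 0 < `|adjoint A y|)) ?normr_gt0//.
rewrite -expr2 -inner_norm -adjointP.
apply: le_trans (ler_inner _ _) _; rewrite mulrA ler_wpM2r //.
by rewrite (mulrC `|_|) AK.
Qed.

Lemma data_projP y : closure (range A) (data_proj A y) /\
  forall v, closure (range A) v -> inner (y - data_proj A y) v = 0.
Proof.
have [|z Az zA] := riesz_range (B := A) (l := fun x => inner y (A x)) (K := `|y|)
  (scalar_inner A y).
  by move=> x; exact: cauchy_schwarz.
pose P := [set z | closure (range A) z /\
  forall v, closure (range A) v -> inner (y - z) v = 0].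
suff : P (data_proj A y) by [].
apply: (@getPex _ P); exists z; split=> //; apply: inner_closure0 => _ [x _ <-].
by rewrite innerBl zA subrr.
Qed.
End Adjoint.

(** * Bernstein polynomials *)

(** The factorial moments of the binomial distribution, as a polynomial identity:
it expresses 'X^j exactly in the Bernstein basis of any larger degree.  It
follows from k C(N, k) = N C(N - 1, k - 1) by induction on j. *)
Lemma sum_ffact_bernstein {A : comNzRingType} (x z : A) (j N : nat) :
  \sum_(k < N.+1) (k ^_ j * 'C(N, k))%:R * (x ^+ k * z ^+ (N - k)) =
  (N ^_ j)%:R * x ^+ j * (x + z) ^+ (N - j).
Proof.
elim: j N => [|j IH] N.
  rewrite ffactn0 expr0 !mul1r subn0 addrC exprDn; apply: eq_bigr => k _.
  by rewrite ffactn0 mul1n mulr_natl mulrC.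
case: N => [|N]; first by rewrite big_ord1 !ffact0n mul0n !mul0r.
rewrite big_ord_recl /= ffact0n mul0n mul0r add0r.
rewrite ffactSS subSS -mulrA exprS natrM.
transitivity (N.+1%:R * x * ((N ^_ j)%:R * x ^+ j * (x + z) ^+ (N - j))); last by ring.
rewrite -IH big_distrr /=; apply: eq_bigr => k _.
rewrite /bump /= add1n subSS ffactSS.
have -> : (k.+1 * k ^_ j * 'C(N.+1, k.+1) = N.+1 * (k ^_ j * 'C(N, k)))%N.
  by rewrite mulnAC -mul_bin_diag /=; lia.
by rewrite exprS natrM; ring.
Qed.

(** The Bernstein coefficients of 'X^j tend to its values at the nodes k / N: each
of the j factors (k - i) / (N - i) differs from k / N by at most i / (N - i). *)
Lemma ffact_ratio_approx {R : realFieldType} (j k N : nat) :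
  (k <= N)%N -> (j < N)%N ->
  `|(k ^_ j)%:R / (N ^_ j)%:R - (k%:R / N%:R) ^+ j| <= (j ^ 2)%:R / (N - j)%:R :> R.
Proof.
move=> kN; elim: j => [|j IH] jN.
  by rewrite !ffactn0 divr1 expr0 subrr normr0 mul0r.
have {}IH := IH (ltnW jN).
have N0 : 0 < N%:R :> R by rewrite ltr0n; lia.
set x : R := k%:R / N%:R in IH *.
have x0 : 0 <= x by rewrite divr_ge0.
have x1 : x <= 1 by rewrite ler_pdivrMr // mul1r ler_nat.
have Nj0 : 0 < (N ^_ j)%:R :> R by rewrite ltr0n ffact_gt0; lia.
pose a : R := (k ^_ j)%:R / (N ^_ j)%:R.
have a0 : 0 <= a by rewrite divr_ge0.
have a1 : a <= 1.
  rewrite ler_pdivrMr // mul1r ler_nat.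
  by elim: j {IH jN Nj0 a a0} => // j IHj; rewrite !ffactnSr leq_mul ?leq_sub2r.
have d0 : 0 < (N - j)%:R :> R by rewrite ltr0n; lia.
have d1 : 0 < (N - j.+1)%:R :> R by rewrite ltr0n; lia.
have -> : (k ^_ j.+1)%:R / (N ^_ j.+1)%:R = a * ((k%:R - j%:R) / (N - j)%:R) :> R.
  rewrite !ffactnSr !natrM /a.
  have [jk|kj] := leqP j k; first by rewrite natrB //; field; rewrite !gt_eqF.
  by rewrite (ffact_small kj) !mul0r.
have E : `|(k%:R - j%:R) / (N - j)%:R - x| <= j%:R / (N - j)%:R.
  have -> : (k%:R - j%:R) / (N - j)%:R - x = - (j%:R * (1 - x)) / (N - j)%:R.
    have NjE : (N - j)%:R = N%:R - j%:R :> R by rewrite natrB // ltnW // ltnW.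
    move: d0; rewrite NjE /x => d0; field.
    by rewrite (gt_eqF N0) (gt_eqF d0).
  rewrite mulNr normrN ger0_norm; last by rewrite divr_ge0 // mulr_ge0 // subr_ge0.
  by rewrite ler_pM2r ?invr_gt0 // ler_piMr // gerBl.
have -> : a * ((k%:R - j%:R) / (N - j)%:R) - x ^+ j.+1 =
   a * ((k%:R - j%:R) / (N - j)%:R - x) + x * (a - x ^+ j) by rewrite exprS; ring.
rewrite -/a in IH; clearbody a x.
apply: le_trans (ler_normD _ _) _; rewrite !normrM (ger0_norm a0) (ger0_norm x0).
apply: le_trans (lerD (ler_piMl _ a1) (ler_piMl _ x1)) _ => //.
apply: le_trans (lerD E IH) _.
apply: le_trans (_ : (j.+1 ^ 2)%:R / (N - j)%:R <= _).
  rewrite -mulrDl -natrD ler_pM2r ?invr_gt0 // ler_nat; clear; nia.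
by rewrite ler_wpM2l // lef_pV2 ?posrE // ler_nat leq_sub2l.
Qed.

Lemma ge0_harmonic {R : realType} (a C : R) :
  (forall n, - (C * n.+1%:R^-1) <= a) -> 0 <= a.
Proof.
move=> aC; rewrite leNgt; apply/negP => a0.
have C0 : 0 < C by have := aC 0%N; rewrite invr1 mulr1; lra.
have e0 : 0 < - a / C by rewrite divr_gt0 // oppr_gt0.
have [n _ /(_ n (leqnn n)) /=] := near_infty_natSinv_lt (PosNum e0).
rewrite ltr_pdivlMr // ; move: n.+1%:R^-1 (aC n) => r; lra.
Qed.

(** In the Bernstein basis of large degree the coefficients of p are close to its
values at the nodes, so they are almost nonnegative, and L is nonnegative on the
basis.  This is the algebraic half of the Hausdorff moment problem. *)
Lemma bernstein_positive {R : realType} (L : {poly R} -> R) (m : R) (p : {poly R}) :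
  scalar L -> 0 < m -> (forall i j, 0 <= L ('X^i * (m%:P - 'X) ^+ j)) ->
  (forall t, 0 <= t <= m -> 0 <= p.[t]) -> 0 <= L p.
Proof.
move=> lin_L m0 L0 p0.
have LD u v : L (u + v) = L u + L v by rewrite -[u]scale1r lin_L mul1r scale1r.
have L00 : L 0 = 0 by apply: (addrI (L 0)); rewrite -LD !addr0.
have LZ a v : L (a *: v) = a * L v by rewrite -[a *: v]addr0 lin_L L00 addr0.
have Lsum n (F : 'I_n -> {poly R}) : L (\sum_i F i) = \sum_i L (F i).
  exact: (big_morph L LD L00).
pose C := \sum_(j < size p) `|p`_j * m ^+ j| * (size p ^ 2)%:R.
apply: (@ge0_harmonic _ _ (C * L 1)) => n.
(* so that N - j exceeds n for every j < size p *)
pose N := (size p + n.+1)%N.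
pose w (k : 'I_N.+1) := 'C(N, k)%:R * L ('X^k * (m%:P - 'X) ^+ (N - k)).
have w0 k : 0 <= w k by rewrite mulr_ge0.
have Lmoment j : (j <= N)%N -> m ^+ N * L 'X^j =
    \sum_k w k * (m ^+ j * ((k ^_ j)%:R / (N ^_ j)%:R)).
  move=> jN.
  have Nj0 : (N ^_ j)%:R != 0 :> R by rewrite pnatr_eq0 -lt0n ffact_gt0.
  have := congr1 L (sum_ffact_bernstein 'X (m%:P - 'X) j N).
  rewrite (addrC 'X) subrK -polyC_exp Lsum -mulrA mulr_natl.
  rewrite -scaler_nat LZ (mulrC 'X^j) mul_polyC LZ => E.
  apply: (mulfI Nj0); transitivity (m ^+ j * ((N ^_ j)%:R * (m ^+ (N - j) * L 'X^j))).
    have -> : m ^+ N = m ^+ j * m ^+ (N - j) by rewrite -exprD subnKC.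
    by ring.
  rewrite -E !big_distrr /=; apply: eq_bigr => k _.
  by rewrite mulr_natl -scaler_nat LZ natrM /w; field.
have Lp : m ^+ N * L p = \sum_k w k *
    \sum_(j < size p) p`_j * m ^+ j * ((k ^_ j)%:R / (N ^_ j)%:R).
  rewrite -{1}[p]coefK poly_def Lsum big_distrr /=.
  have pN (j : 'I_(size p)) : (j <= N)%N.
    exact: leq_trans (ltnW (ltn_ord j)) (leq_addr _ _).
  under eq_bigr => j _ do rewrite LZ mulrCA Lmoment // big_distrr /=.
  rewrite exchange_big; apply: eq_bigr => k _; rewrite big_distrr /=.
  by apply: eq_bigr => j _; ring.
have L1 : m ^+ N * L 1 = \sum_k w k.
  rewrite -[1](expr0 'X) Lmoment //; apply: eq_bigr => k _.
  by rewrite !ffactn0 divr1 !mulr1.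
have coef_ge (k : 'I_N.+1) : - (C / n.+1%:R) <=
    \sum_(j < size p) p`_j * m ^+ j * ((k ^_ j)%:R / (N ^_ j)%:R).
  have kN : (k <= N)%N by rewrite -ltnS.
  have N0 : 0 < N%:R :> R by rewrite ltr0n /N; lia.
  have kN01 : 0 <= m * (k%:R / N%:R) <= m.
    apply/andP; split; first by rewrite mulr_ge0 ?divr_ge0 // ltW.
    by rewrite ler_piMr ?(ltW m0) // ler_pdivrMr // mul1r ler_nat.
  apply: le_trans (_ : - C / n.+1%:R + p.[m * (k%:R / N%:R)] <= _).
    by rewrite mulNr lerDl p0.
  rewrite horner_coef mulNr addrC lerBlDr -lerBlDl -sumrB.
  apply: le_trans (ler_norm _) _; apply: le_trans (ler_norm_sum _ _ _) _.
  rewrite /C mulr_suml; apply: ler_sum => j _.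
  rewrite exprMn mulrA -mulrBr normrM -mulrA ler_wpM2l //.
  rewrite distrC; have jN : (j < N)%N by rewrite /N; have := ltn_ord j; lia.
  apply: le_trans (ffact_ratio_approx kN jN) _.
  apply: ler_pM; rewrite ?invr_ge0 ?ler_nat ?leq_exp2r ?(ltnW (ltn_ord j)) //.
  rewrite lef_pV2 ?posrE ?ltr0n ?ler_nat /N; have := ltn_ord j; lia.
rewrite -(ler_pM2l (exprn_gt0 N m0)) Lp.
have -> : m ^+ N * - (C * L 1 / n.+1%:R) = (m ^+ N * L 1) * - (C / n.+1%:R) by ring.
by rewrite L1 big_distrl /=; apply: ler_sum => k _; apply: ler_wpM2l.
Qed.

Lemma heine_cantor {R : realType} (b : R) (g : R -> R) :
  {within `[0, b], continuous g} -> forall e : R, 0 < e ->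
  exists2 d, 0 < d & forall s t : R, 0 <= s <= b -> 0 <= t <= b ->
    `|s - t| < d -> `|g s - g t| < e.
Proof.
move=> /subspace_continuousP cg e e0.
have K := @segment_compact R 0 b.
pose P (d s : R) := s \in `[0, b] -> forall t, t \in `[0, b] ->
  `|s - t| < d -> `|g s - g t| < e.
have : \forall d \near 0^'+, `[0, b]%classic `<=` P d.
  move/compact_near_coveringP : K; apply => s sb.
  have := cg s sb; move/cvgrPdist_lt => /(_ (e / 2)).
  rewrite divr_gt0 // => /(_ isT); rewrite near_withinE => /nbhs_ballP[r /= r0 rg].
  have r2 : 0 < r / 2 by rewrite divr_gt0.
  exists (ball s (r / 2), [set d | 0 < d < r / 2]) => /=.
    split; first exact: nbhsx_ballx.
    near=> d; apply/andP; split; near: d.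
      exact: nbhs_right_gt.
    exact: nbhs_right_lt.
  move=> [s' d] /= [ss' /andP[d0 dr]] s'b t tb s't.
  have {}ss' : `|s - s'| < r / 2 by rewrite -ball_normE in ss'.
  have h1 : `|g s - g s'| < e / 2.
    by apply: rg => //; rewrite -ball_normE /=; lra.
  have h2 : `|g s - g t| < e / 2.
    apply: rg => //; rewrite -ball_normE /= -(subrKA s').
    by apply: le_lt_trans (ler_normD _ _) _; lra.
  rewrite -(subrKA (g s)); apply: le_lt_trans (ler_normD _ _) _.
  by rewrite distrC; lra.
move=> H; have : \forall d \near 0^'+, (0 < d) /\ `[0, b]%classic `<=` P d.
  by near=> d; split; near: d => //; exact: nbhs_right_gt.
move=> /filter_ex[d [d0 dP]]; exists d => // s t sb tb st.
by apply: (dP s).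
Unshelve. all: by end_near. Qed.

(** Bernstein's proof: the mean of |g (s k) - g t| under the binomial weights is
controlled by the modulus of continuity and by the variance t (b - t) / N. *)
Lemma weierstrass {R : realType} (b : R) (g : R -> R) : 0 < b ->
  {within `[0, b], continuous g} -> forall e : R, 0 < e ->
  exists p : {poly R}, forall t : R, 0 <= t <= b -> `|p.[t] - g t| <= e.
Proof.
move=> b0 cg e e0.
have e2 : 0 < e / 2 by rewrite divr_gt0.
have [d d0 dg] := heine_cantor cg e2.
have [G G0 gG] : exists2 G : R, 0 <= G & forall t, 0 <= t <= b -> `|g t| <= G.
  have [c1 _ h1] := EVT_max (ltW b0) cg; have [c2 _ h2] := EVT_min (ltW b0) cg.
  exists (`|g c1| + `|g c2|); first exact: addr_ge0.
  move=> t tb; rewrite ler_norml; apply/andP; split.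
    have := h2 t tb; have := ler_norm (- g c2); rewrite normrN.
    by have := normr_ge0 (g c1); lra.
  by have := h1 t tb; have := ler_norm (g c1); have := normr_ge0 (g c2); lra.
pose K := 2 * G / d ^+ 2.
have K0 : 0 <= K by apply: divr_ge0; [exact: mulr_ge0|exact: sqr_ge0].
(* beyond the distance d the quadratic term dominates the oscillation 2 * G *)
have gK s t : 0 <= s <= b -> 0 <= t <= b ->
    `|g s - g t| <= e / 2 + K * (s - t) ^+ 2.
  move=> sb tb; have [st|st] := ltP `|s - t| d.
    apply: le_trans (ltW (dg _ _ sb tb st)) _; rewrite lerDl mulr_ge0 //.
    exact: sqr_ge0.
  apply: le_trans (_ : 2 * G <= _).
    apply: le_trans (ler_normB _ _) _.
    by have := gG s sb; have := gG t tb; lra.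
  apply: le_trans (_ : K * (s - t) ^+ 2 <= _); last by rewrite lerDr ltW.
  rewrite /K mulrAC -mulrA ler_peMr ?mulr_ge0 // ler_pdivlMr ?exprn_gt0 // mul1r.
  by rewrite -[leRHS]real_normK ?num_real // ler_sqr ?nnegrE // ltW.
have [N N2 KN] : exists2 N, (2 <= N)%N & K * b ^+ 2 / N%:R <= e / 2.
  have h : 0 < e / 2 / (K * b ^+ 2 + 1).
    by rewrite divr_gt0 // ltr_wpDl // mulr_ge0 // sqr_ge0.
  have [n _ /(_ n.+1 (leqnSn n)) /=] := near_infty_natSinv_lt (PosNum h).
  have Kb1 : 0 < K * b ^+ 2 + 1.
    by rewrite ltr_wpDl // mulr_ge0 // sqr_ge0.
  rewrite ltr_pdivlMr // => hn; exists n.+2 => //.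
  rewrite mulrC; apply: le_trans (ltW hn).
  by rewrite ler_wpM2l // lerDl.
have N0 : 0 < N%:R :> R by rewrite ltr0n ltnW.
pose s (k : 'I_N.+1) := b * (k%:R / N%:R).
have sb k : 0 <= s k <= b.
  apply/andP; split; first by rewrite mulr_ge0 ?divr_ge0 // ltW.
  by rewrite ler_piMr ?(ltW b0) // ler_pdivrMr // mul1r ler_nat -ltnS.
exists (\sum_(k < N.+1) ('C(N, k)%:R * g (s k) / b ^+ N) *:
  ('X^k * (b%:P - 'X) ^+ (N - k))) => t tb.
have /andP[t0 tb'] := tb.
pose w (k : 'I_N.+1) := 'C(N, k)%:R * (t ^+ k * (b - t) ^+ (N - k)) / b ^+ N.
have w0 k : 0 <= w k.
  by rewrite divr_ge0 ?exprn_ge0 ?mulr_ge0 ?exprn_ge0 ?subr_ge0 // ltW.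
have wmoment j : (j <= N)%N ->
    \sum_(k < N.+1) (k ^_ j)%:R * w k = (N ^_ j)%:R * (t / b) ^+ j.
  move=> jN; have := sum_ffact_bernstein t (b - t) j N.
  rewrite (addrC t) subrK => /(congr1 ( *%R (b ^+ N)^-1)).
  have bN : b ^+ N = b ^+ j * b ^+ (N - j) by rewrite -exprD subnKC.
  rewrite big_distrr /= => E.
  transitivity (\sum_(i < N.+1) (b ^+ N)^-1 *
     ((i ^_ j * 'C(N, i))%:R * (t ^+ i * (b - t) ^+ (N - i)))).
    by apply: eq_bigr => k _; rewrite /w natrM; ring.
  rewrite E bN exprMn exprVn; field.
  by rewrite !expf_neq0 // gt_eqF.
have w1 : \sum_k w k = 1.
  have := wmoment 0%N (leq0n _); rewrite ffactn0 expr0 mul1r => <-.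
  by apply: eq_bigr => k _; rewrite ffactn0 mul1r.
have var : \sum_k w k * (s k - t) ^+ 2 = t * (b - t) / N%:R.
  transitivity (\sum_(k < N.+1) ((b / N%:R) ^+ 2 * ((k ^_ 2)%:R * w k) +
     ((b / N%:R) ^+ 2 - 2 * b * t / N%:R) * ((k ^_ 1)%:R * w k) + t ^+ 2 * w k)).
    apply: eq_bigr => k _; rewrite ffactn1.
    have -> : (k ^_ 2)%:R = k%:R * (k%:R - 1) :> R.
      rewrite ffactnSr ffactn1 natrM; case: (nat_of_ord k) => [|n].
        by rewrite !mul0r.
      by rewrite subn1 /= -natr1 addrK.
    by rewrite /s; ring.
  rewrite !big_split /= -!big_distrr /= w1 !wmoment ?(ltnW N2) //.
  rewrite ffactnSr ffactn1 natrM natrB ?(ltnW N2) //.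
  by field; rewrite !gt_eqF.
have -> : (\sum_(k < N.+1) ('C(N, k)%:R * g (s k) / b ^+ N) *:
    ('X^k * (b%:P - 'X) ^+ (N - k))).[t] - g t = \sum_k w k * (g (s k) - g t).
  under [RHS]eq_bigr => k _ do rewrite mulrBr.
  rewrite sumrB -big_distrl /= w1 mul1r horner_sum; congr (_ - _).
  apply: eq_bigr => k _.
  by rewrite hornerZ hornerM hornerXn horner_exp hornerD hornerN hornerC hornerX /w; ring.
apply: le_trans (ler_norm_sum _ _ _) _.
apply: le_trans (_ : \sum_k w k * (e / 2 + K * (s k - t) ^+ 2) <= _).
  by apply: ler_sum => k _; rewrite normrM ger0_norm // ler_wpM2l // gK.
have -> : \sum_k w k * (e / 2 + K * (s k - t) ^+ 2) =
    e / 2 * (\sum_k w k) + K * \sum_k w k * (s k - t) ^+ 2.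
  by rewrite !big_distrr -big_split /=; apply: eq_bigr => k _; ring.
rewrite w1 var mulr1.
rewrite [leRHS](splitr e) lerD2l; apply: le_trans KN.
rewrite -[leRHS]mulrA ler_wpM2l // ler_pM2r ?invr_gt0 // expr2.
by apply: ler_pM => //; [rewrite subr_ge0|rewrite gerBl].
Qed.

(** * Polynomials of a positive selfadjoint operator *)

Section PolynomialCalculus.
Context {R : realType} {H : hilbertType R} (T : {linear H -> H}).
Implicit Types (p q : {poly R}) (u v w : H).

Lemma horner_op_widen n p w : (size p <= n)%N ->
  horner_op p T w = \sum_(i < n) p`_i *: iter i T w.
Proof.
move=> pn; rewrite /horner_op (big_ord_widen n (fun i => p`_i *: iter i T w)) //.
rewrite big_mkcond; apply: eq_bigr => i _; case: ltnP => // pi.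
by rewrite nth_default // scale0r.
Qed.

Lemma horner_opP a p q w :
  horner_op (a *: p + q) T w = a *: horner_op p T w + horner_op q T w.
Proof.
pose n := maxn (size (a *: p + q)) (maxn (size p) (size q)).
rewrite !(@horner_op_widen n) ?leq_max ?leqnn ?orbT //.
rewrite scaler_sumr -big_split; apply: eq_bigr => i _ /=.
by rewrite coefD coefZ scalerDl scalerA.
Qed.

Lemma horner_opD p q w : horner_op (p + q) T w = horner_op p T w + horner_op q T w.
Proof. by rewrite -[p]scale1r horner_opP !scale1r. Qed.

Lemma horner_opC c w : horner_op c%:P T w = c *: w.
Proof.
by rewrite (@horner_op_widen 1) ?size_polyC_leq1 // big_ord1 coefC.
Qed.

Lemma horner_opZ a p w : horner_op (a *: p) T w = a *: horner_op p T w.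
Proof.
by rewrite -[a *: p]addr0 horner_opP (horner_opC 0) scale0r addr0.
Qed.

Lemma horner_opB p q w : horner_op (p - q) T w = horner_op p T w - horner_op q T w.
Proof. by rewrite horner_opD -scaleN1r horner_opZ scaleN1r. Qed.

Lemma horner_opMX p w : horner_op (p * 'X) T w = T (horner_op p T w).
Proof.
have s : (size (p * 'X)%R <= (size p).+1)%N.
  by apply: leq_trans (size_polyMleq _ _) _; rewrite size_polyX addn2.
rewrite (horner_op_widen _ s) big_ord_recl coefMX /= scale0r add0r.
rewrite /horner_op linear_sum; apply: eq_bigr => i _.
by rewrite coefMX /= linearZZ.
Qed.

Lemma horner_opX w : horner_op 'X T w = T w.
Proof. by rewrite -['X]mul1r horner_opMX (horner_opC 1) scale1r. Qed.

Lemma horner_opM p q w : horner_op (p * q) T w = horner_op p T (horner_op q T w).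
Proof.
elim/poly_ind: p w => [|p c IH] w.
  by rewrite mul0r !(horner_opC 0) !scale0r.
rewrite mulrDl mulrAC !horner_opD !horner_opMX IH mul_polyC horner_opZ.
by rewrite horner_opC.
Qed.

Lemma horner_op_linear p : linear (horner_op p T).
Proof.
move=> a u v; elim/poly_ind: p => [|p c IH].
  by rewrite !(horner_opC 0) !scale0r scaler0 addr0.
rewrite !horner_opD !horner_opMX !horner_opC IH linearP scalerDr !scalerA mulrC.
by rewrite scalerDr !scalerA [in RHS]addrACA.
Qed.

Lemma horner_op_comm (S : {linear H -> H}) p w :
  (forall v, T (S v) = S (T v)) -> horner_op p T (S w) = S (horner_op p T w).
Proof.
move=> TS; elim/poly_ind: p => [|p c IH].
  by rewrite !(horner_opC 0) !scale0r linear0.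
by rewrite !horner_opD !horner_opMX !horner_opC IH TS linearD linearZZ.
Qed.

Hypothesis Tsym : forall u v, inner (T u) v = inner u (T v).

Lemma inner_horner_op p u v : inner (horner_op p T u) v = inner u (horner_op p T v).
Proof.
elim/poly_ind: p u v => [|p c IH] u v.
  by rewrite !(horner_opC 0) !scale0r inner0l inner0r.
by rewrite !horner_opD !horner_opMX !horner_opC innerDl innerDr innerZl innerZr
  Tsym IH -horner_opX -horner_opM mulrC horner_opM horner_opX.
Qed.

Hypothesis Tpos : forall u, 0 <= inner (T u) u.

(** The spectral measure of u is carried by ]-oo, m], expressed through the cyclic
subspace that u generates. *)
Definition spectral_bound m u :=
  forall q, inner (T (horner_op q T u)) (horner_op q T u) <= m * `|horner_op q T u| ^+ 2.

(** Cauchy-Schwarz for the semidefinite form <T _, _>, in disguise: the form is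
nonnegative at v - t (T v), and t := 1 / m is the best choice. *)
Lemma spectral_bound_norm m u : 0 <= m -> spectral_bound m u ->
  forall q, `|T (horner_op q T u)| ^+ 2 <=
    m * inner (T (horner_op q T u)) (horner_op q T u).
Proof.
move=> m0 um q; set v := horner_op q T u.
have Tv : inner (T (T v)) (T v) <= m * `|T v| ^+ 2.
  by have := um (q * 'X); rewrite horner_opMX -/v.
have quad t : 0 <= inner (T v) v - 2 * t * `|T v| ^+ 2 + t ^+ 2 * (m * `|T v| ^+ 2).
  apply: le_trans (Tpos (v - t *: T v)) _.
  rewrite linearB linearZZ /= !innerBl !innerBr !innerZl !innerZr.
  rewrite (Tsym (T v) v).
  by have := ler_wpM2l (sqr_ge0 t) Tv; rewrite -!inner_norm; lra.
have [m00|mN0] := eqVneq m 0; last first.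
  have mp : 0 < m by rewrite lt_def mN0.
  have := quad m^-1.
  have -> : inner (T v) v - 2 * m^-1 * `|T v| ^+ 2 + m^-1 ^+ 2 * (m * `|T v| ^+ 2)
    = inner (T v) v - `|T v| ^+ 2 / m by field.
  by rewrite subr_ge0 ler_pdivrMr // mulrC.
have Tvv : inner (T v) v = 0.
  by apply/le_anti; rewrite Tpos andbT; have := um q; rewrite m00 mul0r.
by have := quad 1; rewrite Tvv m00; have := sqr_ge0 `|T v|; lra.
Qed.

(** By [bernstein_positive] it is enough to treat 'X^i * (m - 'X)^j.  Up to the
square of a polynomial, which moves to the other side of the inner product,
only the parities of i and j matter; the case where both are odd is
[spectral_bound_norm]. *)
Lemma horner_op_ge0 m u p : 0 <= m -> spectral_bound m u ->
  (forall t, 0 <= t <= m -> 0 <= p.[t]) -> 0 <= inner (horner_op p T u) u.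
Proof.
move=> m0 um p0; have [m00|mN0] := eqVneq m 0.
  have Tu : T u = 0.
    have := spectral_bound_norm m0 um 1.
    rewrite (horner_opC 1) scale1r m00 mul0r => h.
    by apply/eqP; rewrite -normr_eq0 -sqrf_eq0 eq_le h sqr_ge0.
  have -> : horner_op p T u = p.[0] *: u.
    elim/poly_ind: p {p0} => [|p c IH].
      by rewrite (horner_opC 0) horner0.
    rewrite horner_opD horner_opMX IH linearZZ Tu scaler0 add0r horner_opC.
    by rewrite !hornerE.
  by rewrite innerZl inner_norm mulr_ge0 ?sqr_ge0 // p0 // lexx.
have mp : 0 < m by rewrite lt_def mN0.
apply: (bernstein_positive (L := fun q => inner (horner_op q T u) u) _ mp _ p0).
  by move=> a q r; rewrite horner_opP innerDl innerZl.
move=> i j.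
have sq q r : 0 <= inner (horner_op r T (horner_op q T u)) (horner_op q T u) ->
    0 <= inner (horner_op (q ^+ 2 * r) T u) u.
  by move=> h; rewrite expr2 -mulrA horner_opM inner_horner_op (mulrC q) horner_opM.
have [i2 j2] := (odd_double_half i, odd_double_half j).
have -> : 'X^i * (m%:P - 'X) ^+ j = ('X^(i./2) * (m%:P - 'X) ^+ j./2) ^+ 2 *
   ('X^(odd i) * (m%:P - 'X) ^+ (odd j)) :> {poly R}.
  by rewrite -[in LHS]i2 -[in LHS]j2 !exprD exprMn -!exprM -!muln2; ring.
apply: sq; set q := 'X^_ * _ ^+ j./2; set v := horner_op q T u.
have Bv w : horner_op (m%:P - 'X) T w = m *: w - T w.
  by rewrite horner_opB horner_opC horner_opX.
case: (odd i); case: (odd j); rewrite ?expr0 ?expr1 ?mulr1 ?mul1r.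
- rewrite horner_opM Bv horner_opX linearB linearZZ innerBl innerZl (Tsym (T v)).
  by rewrite inner_norm subr_ge0; apply: spectral_bound_norm.
- by rewrite horner_opX.
- by rewrite Bv innerBl innerZl inner_norm subr_ge0; apply: um.
- by rewrite (horner_opC 1) scale1r inner_norm sqr_ge0.
Qed.

(** Positivity applied to e^2 - p^2. *)
Lemma horner_op_norm_le m u p e : 0 <= m -> spectral_bound m u -> 0 <= e ->
  (forall t, 0 <= t <= m -> `|p.[t]| <= e) -> `|horner_op p T u| <= e * `|u|.
Proof.
move=> m0 um e0 pe; rewrite -ler_sqr ?nnegrE ?mulr_ge0 // exprMn -!inner_norm.
rewrite -inner_horner_op -horner_opM -subr_ge0 -innerZl -innerBl -horner_opC -horner_opB.
apply: (horner_op_ge0 m0 um) => t /pe h; rewrite !hornerE subr_ge0 -expr2.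
by rewrite -[leLHS]real_normK ?num_real // ler_sqr ?nnegrE.
Qed.
End PolynomialCalculus.

(** * Continuous functional calculus *)

Lemma norm_small_eq0 {R : realType} {V : normedModType R} (x : V) (C : R) :
  (forall e, 0 < e -> `|x| <= C * e) -> x = 0.
Proof.
move=> xC; apply/eqP; rewrite -normr_le0; apply/ler_addgt0Pr => e e0; rewrite add0r.
have C1 : 0 < `|C| + 1 by rewrite ltr_wpDl.
apply: le_trans (xC (e / (`|C| + 1)) (divr_gt0 e0 C1)) _.
rewrite mulrCA ler_piMr ?(ltW e0) // ler_pdivrMr // mul1r.
by apply: le_trans (ler_norm C) _; rewrite lerDl.
Qed.

Section FunctionalCalculus.
Context {R : realType} {H : hilbertType R} (T : {linear H -> H}) (M : R).
Hypothesis Tsym : forall u v, inner (T u) v = inner u (T v).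
Hypothesis Tpos : forall u, 0 <= inner (T u) u.
Hypothesis M0 : 0 <= M.
Hypothesis TM : forall u, inner (T u) u <= M * `|u| ^+ 2.
Implicit Types (p q : {poly R}) (u v w : H) (g : R -> R) (S : H -> H).

Let spec u : spectral_bound T M u. Proof. by move=> q; apply: TM. Qed.

(** S = g(T), without reference to a sequence: this form is stable under all the
error estimates below, and it is weak enough to follow from any construction of
the functional calculus. *)
Definition op_approx g S := forall e, 0 < e -> exists p,
  (forall t, 0 <= t <= M -> `|p.[t] - g t| <= e) /\
  (forall w, `|horner_op p T w - S w| <= e * `|w|).

Lemma norm_op_le u : `|T u| <= M * `|u|.
Proof.
rewrite -ler_sqr ?nnegrE ?mulr_ge0 // exprMn expr2 -mulrA.
have := spectral_bound_norm Tsym Tpos M0 (@spec u) 1.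
rewrite (horner_opC T 1) scale1r => h; apply: le_trans h _.
by apply: ler_wpM2l.
Qed.

Lemma horner_op_bounded p : exists K, [/\ 0 <= K,
  forall t, 0 <= t <= M -> `|p.[t]| <= K & forall w, `|horner_op p T w| <= K * `|w|].
Proof.
elim/poly_ind: p => [|p c [K [K0 pK opK]]].
  exists 0; split => // [t _|w]; first by rewrite horner0 normr0.
  by rewrite (horner_opC T 0) scale0r normr0 mul0r.
exists (M * K + `|c|); split; first by rewrite addr_ge0 ?mulr_ge0.
  move=> t tM; rewrite !hornerE; apply: le_trans (ler_normD _ _) _.
  rewrite lerD2r normrM mulrC; have /andP[t0 tM'] := tM.
  by apply: ler_pM => //; [rewrite ger0_norm|exact: pK].
move=> w; rewrite horner_opD horner_opMX horner_opC.
apply: le_trans (ler_normD _ _) _; rewrite mulrDl normrZ lerD2r.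
by apply: le_trans (norm_op_le _) _; rewrite -mulrA ler_wpM2l.
Qed.

Lemma op_approx_bounded g S : op_approx g S -> exists K, [/\ 0 <= K,
  forall t, 0 <= t <= M -> `|g t| <= K & forall w, `|S w| <= K * `|w|].
Proof.
move=> /(_ 1 ltr01)[p [pg pS]]; have [K [K0 pK opK]] := horner_op_bounded p.
exists (K + 1); split; first exact: addr_ge0.
  move=> t tM; have -> : g t = p.[t] - (p.[t] - g t) by rewrite subKr.
  by apply: le_trans (ler_normB _ _) _; apply: lerD; [exact: pK|exact: pg].
move=> w; have -> : S w = horner_op p T w - (horner_op p T w - S w) by rewrite subKr.
apply: le_trans (ler_normB _ _) _; rewrite mulrDl.
by apply: lerD; [exact: opK|exact: pS].
Qed.

Lemma op_approx_linear g S : op_approx g S -> linear S.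
Proof.
move=> gS a u v; apply/subr0_eq.
apply: (@norm_small_eq0 _ _ _ (`|a *: u + v| + `|a| * `|u| + `|v|)) => e e0.
have [p [_ pS]] := gS e e0.
have -> : S (a *: u + v) - (a *: S u + S v) =
    - (horner_op p T (a *: u + v) - S (a *: u + v)) +
    a *: (horner_op p T u - S u) + (horner_op p T v - S v).
  by rewrite horner_op_linear scalerBr -addrA addrACA -opprD opprB addrA subrK.
rewrite !mulrDl; apply: le_trans (ler_normD _ _) _.
apply: lerD; last by rewrite mulrC.
apply: le_trans (ler_normD _ _) _; apply: lerD.
  by rewrite normrN mulrC.
by rewrite normrZ -mulrA ler_wpM2l // mulrC.
Qed.

Lemma op_approx_sym g S : op_approx g S -> forall u v, inner (S u) v = inner u (S v).
Proof.
move=> gS u v; apply/subr0_eq; apply: (@norm_small_eq0 _ _ _ (2 * `|u| * `|v|)) => e e0.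
have [p [_ pS]] := gS e e0.
have -> : inner (S u) v - inner u (S v) =
    inner u (horner_op p T v - S v) - inner (horner_op p T u - S u) v.
  by rewrite innerBl innerBr (inner_horner_op Tsym); ring.
apply: le_trans (ler_normB _ _) _.
apply: le_trans (lerD (cauchy_schwarz _ _) (cauchy_schwarz _ _)) _.
have := ler_wpM2l (normr_ge0 u) (pS v); have := ler_wpM2r (normr_ge0 v) (pS u).
by lra.
Qed.

Lemma op_approx_comm g S : op_approx g S -> forall w, T (S w) = S (T w).
Proof.
move=> gS w; apply/subr0_eq; apply: (@norm_small_eq0 _ _ _ (M * `|w| + `|T w|)) => e e0.
have [p [_ pS]] := gS e e0.
have -> : T (S w) - S (T w) =
    (horner_op p T (T w) - S (T w)) - T (horner_op p T w - S w).
  by rewrite horner_op_comm // linearB opprB [RHS]addrC addrA subrK.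
apply: le_trans (ler_normB _ _) _; rewrite mulrDl [leRHS]addrC.
apply: lerD; first by rewrite mulrC.
apply: le_trans (norm_op_le _) _; rewrite -mulrA ler_wpM2l //.
by rewrite mulrC.
Qed.

(** What replaces the spectral theorem: integrating the pointwise
inequality against the spectral measure of u.  For polynomials it is
[horner_op_ge0]; replacing g by an approximation p costs a multiple of the
error, on the function side as well as on the operator side. *)
Lemma op_approx_ge0 g S (a b c k m : R) u : op_approx g S ->
  0 <= m <= M -> spectral_bound T m u ->
  (forall t, 0 <= t <= m -> 0 <= a * g t ^+ 2 + b * (t * g t ^+ 2) + c + k * t) ->
  0 <= a * `|S u| ^+ 2 + b * inner (T (S u)) (S u) + c * `|u| ^+ 2 + k * inner (T u) u.
Proof.
move=> gS /andP[m0 mM] um ge0.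
have [K [K0 gK SK]] := op_approx_bounded gS.
pose B := (`|a| + `|b| * M) * (2 * K + 1).
apply: (@ge0_harmonic _ _ (2 * B * `|u| ^+ 2)) => n.
have e0 : 0 < n.+1%:R^-1 :> R by rewrite invr_gt0.
have e1 : n.+1%:R^-1 <= 1 :> R by rewrite invf_le1 // ler1n.
have [p [pg pS]] := gS _ e0.
move: (n.+1%:R^-1) e0 e1 pg pS => e e0 e1 pg pS.
set P := horner_op p T u.
(* B * e bounds the change of the given combination when p replaces g *)
pose q := (a%:P + b *: 'X) * p ^+ 2 + c%:P + k *: 'X + (B * e)%:P.
have /(horner_op_ge0 Tsym Tpos m0 um) : forall t, 0 <= t <= m -> 0 <= q.[t].
  move=> t tm; have /andP[t0 tm'] := tm.
  have tM : 0 <= t <= M by rewrite t0 (le_trans tm').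
  have d : `|p.[t] ^+ 2 - g t ^+ 2| <= e * (2 * K + 1).
    rewrite subr_sqr normrM; apply: ler_pM => //; first exact: pg.
    have -> : p.[t] + g t = (p.[t] - g t) + 2 * g t by ring.
    apply: le_trans (ler_normD _ _) _; rewrite addrC normrM ger0_norm //.
    by apply: lerD; [rewrite ler_wpM2l // gK|apply: le_trans (pg _ tM) _].
  have ab : `|a + b * t| <= `|a| + `|b| * M.
    apply: le_trans (ler_normD _ _) _; rewrite lerD2l normrM ler_wpM2l //.
    by rewrite ger0_norm // (le_trans tm').
  have -> : q.[t] = (a * g t ^+ 2 + b * (t * g t ^+ 2) + c + k * t) +
    (B * e + (a + b * t) * (p.[t] ^+ 2 - g t ^+ 2)).
    by rewrite /q !hornerE /=; ring.
  apply: addr_ge0; first exact: ge0.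
  have : `|(a + b * t) * (p.[t] ^+ 2 - g t ^+ 2)| <= B * e.
    rewrite normrM /B -mulrA [(2 * K + 1) * e]mulrC.
    by apply: ler_pM.
  by rewrite ler_norml => /andP[+ _]; lra.
have -> : inner (horner_op q T u) u = a * `|P| ^+ 2 + b * inner (T P) P +
    c * `|u| ^+ 2 + k * inner (T u) u + B * e * `|u| ^+ 2.
  rewrite /q !horner_opD !horner_opC horner_opM horner_opD horner_opC.
  rewrite !horner_opZ !horner_opX expr2 horner_opM -/P.
  have F1 : inner (horner_op p T P) u = `|P| ^+ 2.
    by rewrite (inner_horner_op Tsym) -/P inner_norm.
  have F2 : inner (T (horner_op p T P)) u = inner (T P) P.
    by rewrite -horner_op_comm // (inner_horner_op Tsym).
  by rewrite !innerDl !innerZl inner_norm F1 F2; ring.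
have PS : `|P - S u| <= e * `|u| by exact: pS.
have PS2 : `|P + S u| <= (2 * K + 1) * `|u|.
  have -> : P + S u = (P - S u) + 2 *: S u by rewrite scaler_nat mulr2n addrA subrK.
  apply: le_trans (ler_normD _ _) _; rewrite mulrDl mul1r addrC normrZ ger0_norm //.
  rewrite -mulrA; apply: lerD; first by rewrite ler_wpM2l.
  by apply: le_trans PS _; rewrite ler_piMl.
have PSe : `|P - S u| * `|P + S u| <= (2 * K + 1) * e * `|u| ^+ 2.
  apply: le_trans (ler_pM _ _ PS PS2) _ => //.
  by apply: eq_imply_le; ring.
have d1 : a * (`|P| ^+ 2 - `|S u| ^+ 2) <= `|a| * ((2 * K + 1) * e * `|u| ^+ 2).
  apply: le_trans (ler_norm _) _; rewrite normrM ler_wpM2l //.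
  have -> : `|P| ^+ 2 - `|S u| ^+ 2 = inner (P - S u) (P + S u).
    by rewrite innerBl !innerDr !inner_norm (innerC (S u) P); ring.
  exact: le_trans (cauchy_schwarz _ _) PSe.
have d2 : b * (inner (T P) P - inner (T (S u)) (S u)) <=
    `|b| * (M * ((2 * K + 1) * e * `|u| ^+ 2)).
  apply: le_trans (ler_norm _) _; rewrite normrM ler_wpM2l //.
  have -> : inner (T P) P - inner (T (S u)) (S u) = inner (T (P - S u)) (P + S u).
    by rewrite linearB innerBl !innerDr (Tsym (S u) P) (innerC (S u)); ring.
  apply: le_trans (cauchy_schwarz _ _) _.
  apply: le_trans (ler_wpM2r (normr_ge0 _) (norm_op_le _)) _.
  by rewrite -[leLHS]mulrA ler_wpM2l.
by rewrite /B; lra.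
Qed.
(** The limit exists because the norm of p(T) is at most the maximum of |p| on
[0, M].  The interval of the hypothesis is longer than [0, M] in order to be
nondegenerate when M = 0. *)
Lemma op_approx_exists g : {within `[0, M + 1], continuous g} ->
  exists S : H -> H, [/\ linear S, op_approx g S &
    exists p : nat -> {poly R}, forall n : nat,
    (forall t, 0 <= t <= M -> `|(p n).[t] - g t| <= n.+1%:R^-1) /\
    (forall w, `|horner_op (p n) T w - S w| <= 2 * n.+1%:R^-1 * `|w|)].
Proof.
move=> cg; have M1 : 0 < M + 1 by rewrite ltr_wpDl.
have /choice[p pg] (n : nat) : exists p : {poly R}, forall t : R, 0 <= t <= M ->
    `|p.[t] - g t| <= n.+1%:R^-1.
  have n0 : 0 < n.+1%:R^-1 :> R by rewrite invr_gt0.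
  have [p pg] := weierstrass M1 cg n0; exists p => t /andP[t0 tM].
  by apply: pg; rewrite t0 (le_trans tM) // lerDl.
have pc m n w : `|horner_op (p m) T w - horner_op (p n) T w| <=
    (m.+1%:R^-1 + n.+1%:R^-1) * `|w|.
  rewrite -horner_opB; apply: (horner_op_norm_le Tsym Tpos M0 (@spec w)).
    exact: addr_ge0.
  move=> t tM; rewrite hornerD hornerN.
  have -> : (p m).[t] - (p n).[t] = ((p m).[t] - g t) - ((p n).[t] - g t) by ring.
  by apply: le_trans (ler_normB _ _) _; apply: lerD; exact: pg.
have cvgS w : exists x : H, horner_op (p n) T w @[n --> \oo] --> x.
  apply: (@cauchy_harmonic_cvg _ _ _ (2 * `|w| ^+ 2)); first by rewrite mulr_ge0 ?sqr_ge0.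
  move=> m n; apply: le_trans (_ : ((m.+1%:R^-1 + n.+1%:R^-1) * `|w|) ^+ 2 <= _).
    by rewrite ler_sqr ?nnegrE ?mulr_ge0 ?addr_ge0.
  have m1 : m.+1%:R^-1 <= 1 :> R by rewrite invf_le1 // ler1n.
  have n1 : n.+1%:R^-1 <= 1 :> R by rewrite invf_le1 // ler1n.
  rewrite exprMn mulrAC ler_wpM2r ?sqr_ge0 // expr2 ler_wpM2r ?addr_ge0 //.
  by apply: lerD.
have [S pS] := choice cvgS.
have pS2 n w : `|horner_op (p n) T w - S w| <= 2 * n.+1%:R^-1 * `|w|.
  apply/ler_addgt0Pr => e e0.
  have h1 : \forall m \near \oo, `|S w - horner_op (p m) T w| < e.
    by move/cvgr_dist_lt : (pS w); apply.
  have h2 : \forall m \near \oo, (n <= m)%N by exact: nbhs_infty_ge.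
  have [m [Sm nm]] := filter_ex (filterI h1 h2).
  rewrite -(subrKA (horner_op (p m) T w)); apply: le_trans (ler_normD _ _) _.
  apply: lerD; last by rewrite distrC ltW.
  apply: le_trans (pc _ _ _) _; rewrite ler_wpM2r // mulrDl mul1r lerD2l.
  by rewrite lef_pV2 ?posrE // ler_nat.
have gS : op_approx g S.
  move=> e e0; have e2 : 0 < e / 2 by rewrite divr_gt0.
  have [n _ /(_ n (leqnn n)) /= ne] := near_infty_natSinv_lt (PosNum e2).
  exists (p n); split=> [t tM|w].
    by apply: le_trans (pg n t tM) _; move: (n.+1%:R^-1) ne => r; lra.
  apply: le_trans (pS2 n w) _; rewrite ler_wpM2r //.
  by move: (n.+1%:R^-1) ne => r; lra.
exists S; split; [exact: op_approx_linear gS|by []|].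
by exists p => n; split; [exact: pg|exact: pS2].
Qed.
End FunctionalCalculus.

Lemma uniform_cvgP {R : realType} {U : choiceType} {V : normedModType R} (A : set U)
    (f : nat -> U -> V) (g : U -> V) :
  {uniform A, f @ \oo --> g} <->
  forall e : R, 0 < e -> \forall n \near \oo, forall x, A x -> `|g x - f n x| < e.
Proof.
split=> [fg e e0|fg P].
  have := fg [set h | forall y, A y -> ball (g y) e (h y)].
  case.
    apply/uniform_nbhs; exists [set xy | ball xy.1 e xy.2]; split => //.
    exact: (entourage_ball _ (PosNum e0)).
  move=> N _ NP; exists N => // n /NP /= + x Ax => /(_ x Ax).
  by rewrite -ball_normE.
move=> /uniform_nbhs[E [/= + EP]].
rewrite -entourage_ballE => -[e /= e0 eE].
have := fg e e0; apply: filterS => n fn; apply: EP => /= y Ay; apply: eE => /=.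
by rewrite -ball_normE /=; apply: fn.
Qed.

Lemma powR_within_continuous {R : realType} (nu b : R) : 0 < nu -> 0 < b ->
  {within `[0, b], continuous (fun t : R => t `^ nu)}.
Proof.
move=> nu0 b0; have pos x : 0 < x -> {for x, continuous (fun t : R => t `^ nu)}.
  move=> x0; apply: differentiable_continuous.
  by apply/derivable1_diffP/derivable_powR; rewrite in_itv /= x0.
apply/continuous_within_itvP => //; split.
- by move=> x; rewrite in_itv /= => /andP[x0 _]; apply: pos.
- by rewrite powR0 ?gt_eqF //; exact: powR_cvg0.
- by apply: cvg_at_left_filter; exact: pos.
Qed.

Section OperatorNorm.
Context {R : realType} {H : hilbertType R} (T : {linear H -> H}).
Hypothesis bT : exists K : R, forall w, `|T w| <= K * `|w|.

Lemma opnorm_has_sup : has_sup [set `|T x| | x in [set x | `|x| <= 1]].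
Proof.
split; first by exists `|T 0|, 0 => //=; rewrite normr0.
have [K TK] := bT; exists `|K| => _ [x /= x1 <-]; apply: le_trans (TK x) _.
apply: le_trans (_ : `|K| * `|x| <= _); first by rewrite ler_wpM2r // ler_norm.
by rewrite ler_piMr.
Qed.

Lemma opnorm_ge0 : 0 <= opnorm T.
Proof.
apply: (ub_le_sup opnorm_has_sup.2); exists 0; first by rewrite /= normr0.
by rewrite linear0 normr0.
Qed.

Lemma le_opnorm w : `|T w| <= opnorm T * `|w|.
Proof.
have [->|w0] := eqVneq w 0; first by rewrite linear0 !normr0 mulr0.
have nw : 0 < `|w| by rewrite normr_gt0.
have : `|T (`|w|^-1 *: w)| <= opnorm T.
  apply: (ub_le_sup opnorm_has_sup.2); exists (`|w|^-1 *: w) => //=.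
  by rewrite normrZ normfV normr_id mulVf // gt_eqF.
by rewrite linearZZ normrZ normfV normr_id mulrC ler_pdivrMr.
Qed.

Lemma inner_le_opnorm w : inner (T w) w <= opnorm T * `|w| ^+ 2.
Proof.
by apply: le_trans (ler_inner _ _) _; rewrite expr2 mulrA ler_wpM2r // le_opnorm.
Qed.

Hypothesis Tsym : forall u v, inner (T u) v = inner u (T v).
Hypothesis Tpos : forall u, 0 <= inner (T u) u.

(** Existence is needed here to be able to use the defining property of
[fun_calculus], which is a choice among the operators that have it. *)
Lemma fun_calculus_approx (g : R -> R) :
  {within `[0, opnorm T + 1], continuous g} ->
  op_approx T (opnorm T) g (fun_calculus g T).
Proof.
move=> cg; have [S [linS _ [p pS]]] :=
  op_approx_exists Tsym Tpos opnorm_ge0 inner_le_opnorm cg.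
pose P := [set S : H -> H | linear S /\ exists p : nat -> {poly R},
    {uniform `[0, opnorm T], (fun n t => (p n).[t]) @ \oo --> g} /\
    {uniform [set w : H | `|w| <= 1],
       (fun n => horner_op (p n) T) @ \oo --> S}].
have : P (fun_calculus g T).
  apply: (@getPex _ P); exists S; split => //; exists p; split.
    apply/(@uniform_cvgP R R R^o) => e e0.
    have [N _ Ne] := near_infty_natSinv_lt (PosNum e0); exists N => // n /Ne /= ne t.
    rewrite /= in_itv /= => tM; rewrite distrC.
    exact: le_lt_trans ((pS n).1 _ tM) ne.
  apply/uniform_cvgP => e e0; have e2 : 0 < e / 2 by rewrite divr_gt0.
  have [N _ Ne] := near_infty_natSinv_lt (PosNum e2); exists N => // n /Ne /= ne w w1.
  rewrite distrC; apply: le_lt_trans ((pS n).2 w) _.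
  apply: le_lt_trans (_ : 2 * n.+1%:R^-1 < _); first by rewrite ler_piMr.
  by move: (n.+1%:R^-1) ne => r; lra.
move=> [linF [q [/(@uniform_cvgP R R R^o) qg /uniform_cvgP qF]]] e e0.
have [n [qgn qFn]] := filter_ex (filterI (qg e e0) (qF e e0)).
exists (q n); split=> [t tM|w].
  by rewrite distrC ltW // qgn //= in_itv.
set F := fun_calculus g T in linF qF qFn *.
have F0 : F 0 = 0 by have := linF (-1) 0 0; rewrite scaler0 addr0 scaleN1r addNr.
have FZ a u : F (a *: u) = a *: F u by have := linF a u 0; rewrite F0 !addr0.
have q0 : horner_op (q n) T 0 = 0.
  by have := horner_op_linear T (q n) (-1) 0 0; rewrite scaler0 addr0 scaleN1r addNr.
have qZ a u : horner_op (q n) T (a *: u) = a *: horner_op (q n) T u.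
  by have := horner_op_linear T (q n) a u 0; rewrite q0 !addr0.
have [->|w0] := eqVneq w 0; first by rewrite F0 q0 subrr normr0 mulr0.
have nw : `|w| != 0 by rewrite normr_eq0.
have wE : w = `|w| *: (`|w|^-1 *: w) by rewrite scalerA divff // scale1r.
rewrite {1 2}wE FZ qZ -scalerBr normrZ normr_id mulrC ler_wpM2r //.
rewrite distrC ltW // qFn //=.
by rewrite normrZ normfV normr_id mulVf.
Qed.
End OperatorNorm.

(** * Spectral estimates for powers *)

(** Bernoulli's inequality for an integer exponent above a, which is good enough
because the value of C does not matter. *)
Lemma powR_ge_affine {R : realType} (a : R) : 0 < a ->
  exists2 C, 0 <= C & forall x, 0 <= x <= 1 -> 1 - C * (1 - x) <= x `^ a.
Proof.
move=> a0; have [n an] : exists n : nat, a <= n.+1%:R.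
  exists (Num.bound a); apply: ltW; apply: lt_le_trans (archi_boundP (ltW a0)) _.
  by rewrite ler_nat.
exists n.+1%:R => // x /andP[x0 x1].
have [->|xN0] := eqVneq x 0.
  by rewrite powR0 ?gt_eqF // subr0 mulr1 subr_le0 ler1n.
have xp : 0 < x by rewrite lt_def xN0.
apply: le_trans (_ : x ^+ n.+1 <= _); last first.
  by rewrite -powR_mulrn //; apply: ger_powR => //; rewrite xp.
elim: n.+1 => [|k IH]; first by rewrite mul0r subr0 expr0.
have h : x * (1 - k%:R * (1 - x)) <= x ^+ k.+1 by rewrite exprS ler_wpM2l.
apply: le_trans h; rewrite -natr1 -subr_ge0.
have -> : x * (1 - k%:R * (1 - x)) - (1 - (k%:R + 1) * (1 - x)) =
  k%:R * (1 - x) ^+ 2 by ring.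
by rewrite mulr_ge0 ?sqr_ge0.
Qed.

(** Young's inequality for the product of [x `^ a] and 1, with exponents
(a + 1) / a and a + 1. *)
Lemma powR_young {R : realType} (a x : R) : 0 < a -> 0 <= x ->
  x `^ a <= a / (a + 1) * (x * x `^ a) + (a + 1)^-1.
Proof.
move=> a0 x0; have a1 : 0 < a + 1 by rewrite addr_gt0.
have := @conjugate_powR R (x `^ a) 1 ((a + 1) / a) (a + 1).
rewrite !powR1 mulr1 -powRrM => h; apply: le_trans (h _ _ _ _ _) _ => //.
- exact: powR_ge0.
- exact: divr_gt0.
- by field; rewrite !gt_eqF.
have -> : a * ((a + 1) / a) = a + 1 by field; rewrite gt_eqF.
rewrite -(mulr_powRB1 x0 a1) addrK; apply: eq_imply_le.
by rewrite mul1r; field; rewrite !gt_eqF.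
Qed.

Lemma powR_limit1 {R : realType} (q Z W : R) : 0 <= q -> 0 <= Z ->
  (forall k, 0 < k < 1 -> k `^ q * Z <= W) -> Z <= W.
Proof.
move=> q0 Z0 kZW; have [q00|qN0] := eqVneq q 0.
  have := kZW 2^-1; rewrite q00 powRr0 mul1r; apply.
  by rewrite invr_gt0 ltr0n invf_lt1 // ltr1n.
have qp : 0 < q by rewrite lt_def qN0.
have [C C0 hC] := powR_ge_affine qp.
rewrite -subr_ge0; apply: (@ge0_harmonic _ _ (C * Z)) => n.
have n0 : 0 < n.+2%:R^-1 :> R by rewrite invr_gt0.
have n1 : n.+2%:R^-1 < 1 :> R by rewrite invf_lt1 // ltr1n.
have n2 : n.+2%:R^-1 <= n.+1%:R^-1 :> R by rewrite lef_pV2 ?posrE // ler_nat.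
have CZ : 0 <= C * Z by rewrite mulr_ge0.
have := kZW (1 - n.+2%:R^-1); have := hC (1 - n.+2%:R^-1).
have := ler_wpM2l CZ n2.
move: (n.+2%:R^-1) n0 n1 (n.+1%:R^-1) => r r0 r1 s rs h1 h2.
have := ler_wpM2r Z0 (h1 _); have := h2 _.
rewrite subKr => H2 H1.
have {}H1 := H1 ltac:(by apply/andP; split; lra).
have {}H2 := H2 ltac:(by apply/andP; split; lra).
by lra.
Qed.

Section SpectralEstimates.
Context {R : realType} {H : hilbertType R} (T : {linear H -> H}) (M : R).
Hypothesis Tsym : forall u v, inner (T u) v = inner u (T v).
Hypothesis Tpos : forall u, 0 <= inner (T u) u.
Hypothesis M0 : 0 <= M.
Hypothesis TM : forall u, inner (T u) u <= M * `|u| ^+ 2.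

(** The number m is the supremum of the Rayleigh quotient on the range of S.  This
range is stable under every p(T), so m bounds the spectral measures of all its
elements. *)
Lemma near_eigenvector (S : {linear H -> H}) (e : R) :
  (forall v, T (S v) = S (T v)) ->
  (forall v, inner (T (S v)) (S v) <= e * `|S v| ^+ 2) ->
  (exists v, 0 < inner (T (S v)) (S v)) ->
  exists m, [/\ 0 < m, m <= e, forall v, spectral_bound T m (S v) &
    forall k, k < 1 -> exists v, `|S v| = 1 /\ k * m <= inner (T (S v)) (S v)].
Proof.
move=> TS Te [v0 v0pos].
pose E := [set inner (T (S v)) (S v) | v in [set v | `|S v| = 1]].
have Eub : has_ubound E.
  by exists e => _ [v /= v1 <-]; rewrite (le_trans (Te v)) // v1 expr1n mulr1.
have unit v : S v != 0 -> `|S (`|S v|^-1 *: v)| = 1.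
  by move=> Sv; rewrite linearZZ normrZ normfV normr_id mulVf // normr_eq0.
have quad v : S v != 0 -> inner (T (S v)) (S v) =
    `|S v| ^+ 2 * inner (T (S (`|S v|^-1 *: v))) (S (`|S v|^-1 *: v)).
  move=> Sv; rewrite !linearZZ innerZl innerZr; field.
  by rewrite normr_eq0.
have Sv0 : S v0 != 0.
  by apply/eqP => h; move: v0pos; rewrite h inner0r ltxx.
have hE : has_sup E.
  split => //; pose v := `|S v0|^-1 *: v0.
  by exists (inner (T (S v)) (S v)), v => //; exact: unit.
have supE v : inner (T (S v)) (S v) <= sup E * `|S v| ^+ 2.
  have [->|Sv] := eqVneq (S v) 0; first by rewrite inner0r normr0 expr0n mulr0.
  rewrite quad // mulrC ler_wpM2r ?sqr_ge0 //; apply: ub_le_sup => //.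
  by exists (`|S v|^-1 *: v) => //; exact: unit.
have m0 : 0 < sup E.
  have h := lt_le_trans v0pos (supE v0).
  by move: h; rewrite pmulr_lgt0 // exprn_gt0 // normr_gt0.
exists (sup E); split => //.
- apply: ge_sup; first exact: hE.1.
  by move=> _ [v /= v1 <-]; rewrite (le_trans (Te v)) // v1 expr1n mulr1.
- by move=> v q; rewrite horner_op_comm.
move=> k k1; have d0 : 0 < sup E - k * sup E.
  by rewrite subr_gt0 gtr_pMl.
have [_ [v /= v1 <-]] := sup_adherent d0 hE.
by rewrite subKr => /ltW h; exists v.
Qed.

Variables (nu : R) (S : H -> H).
Hypothesis nu0 : 0 < nu.
Hypothesis hS : op_approx T M (fun t => t `^ nu) S.

Let powR_sqr (x : R) : (x `^ nu) ^+ 2 = x `^ (2 * nu).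
Proof. by rewrite -powR_mulrn ?powR_ge0 // -powRrM mulrC. Qed.

(** [powR_young] at t / r, integrated against the spectral measure of w.  The
parameter r stands for a typical spectral value of w; optimizing it gives the
interpolation inequality. *)
Lemma power_interpolation w r : 0 < r ->
  `|S w| ^+ 2 <= (2 * nu) / (2 * nu + 1) / r * inner (T (S w)) (S w) +
    r `^ (2 * nu) / (2 * nu + 1) * `|w| ^+ 2.
Proof.
move=> r0; have a0 : 0 < 2 * nu by rewrite mulr_gt0.
have MM : 0 <= M <= M by rewrite M0 lexx.
have sM : spectral_bound T M w by move=> q; apply: TM.
have := @op_approx_ge0 _ _ T M Tsym Tpos M0 TM _ S (-1) (2 * nu / (2 * nu + 1) / r)
  (r `^ (2 * nu) / (2 * nu + 1)) 0 M w hS MM sM.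
rewrite mulN1r mul0r addr0 => h.
rewrite -subr_ge0; apply: le_trans (h _) _; last first.
  by apply: eq_imply_le; ring.
move=> t /andP[t0 _]; rewrite powR_sqr mul0r addr0.
have tr0 : 0 <= t / r by rewrite divr_ge0 // ltW.
have := ler_wpM2l (powR_ge0 r (2 * nu)) (powR_young a0 tr0).
have E : r `^ (2 * nu) * (t / r) `^ (2 * nu) = t `^ (2 * nu).
  by rewrite -powRM ?(ltW r0) // mulrC divfK // gt_eqF.
rewrite mulrDr E => {h} h.
have -> : - 1 * t `^ (2 * nu) + 2 * nu / (2 * nu + 1) / r * (t * t `^ (2 * nu)) +
   r `^ (2 * nu) / (2 * nu + 1) = (r `^ (2 * nu) * (2 * nu / (2 * nu + 1) *
   (t / r * (t / r) `^ (2 * nu))) + r `^ (2 * nu) / (2 * nu + 1)) - t `^ (2 * nu).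
  have -> : r `^ (2 * nu) * (2 * nu / (2 * nu + 1) * (t / r * (t / r) `^ (2 * nu)))
    = 2 * nu / (2 * nu + 1) * (t / r) * (r `^ (2 * nu) * (t / r) `^ (2 * nu)) by ring.
  by rewrite E; ring.
by rewrite subr_ge0.
Qed.

Lemma power_le m u : 0 < m <= M -> spectral_bound T m u ->
  inner (T (S u)) (S u) <= m * m `^ (2 * nu) * `|u| ^+ 2.
Proof.
move=> /andP[m0 mM] um; have mM' : 0 <= m <= M by rewrite ltW.
have := @op_approx_ge0 _ _ T M Tsym Tpos M0 TM _ S 0 (-1)
  (m * m `^ (2 * nu)) 0 m u hS mM' um.
rewrite !mul0r add0r addr0 mulN1r addrC subr_ge0; apply.
move=> t /andP[t0 tm]; rewrite !mul0r add0r addr0 powR_sqr mulN1r addrC subr_ge0.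
apply: ler_pM => //; first exact: powR_ge0.
by apply: ge0_ler_powR; rewrite ?nnegrE // ?mulr_ge0 // ltW.
Qed.

(** Together with [power_le]: if the Rayleigh quotient of u almost attains the
upper bound m of its spectrum, then S acts on u like multiplication by
[m `^ nu], as the spectral measure of u concentrates at m. *)
Lemma power_ge : exists2 C, 0 <= C & forall m u, 0 < m <= M ->
  spectral_bound T m u ->
  m `^ (2 * nu) * ((1 - C) * `|u| ^+ 2 + C / m * inner (T u) u) <= `|S u| ^+ 2.
Proof.
have [C C0 hC] := @powR_ge_affine R (2 * nu) (mulr_gt0 (ltr0n R 2) nu0).
exists C => // m u /andP[m0 mM] um; have mM' : 0 <= m <= M by rewrite ltW.
have := @op_approx_ge0 _ _ T M Tsym Tpos M0 TM _ S 1 0 (- (m `^ (2 * nu) * (1 - C)))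
  (- (m `^ (2 * nu) * (C / m))) m u hS mM' um.
move=> h; rewrite -subr_ge0; apply: le_trans (h _) _; last first.
  by apply: eq_imply_le; ring.
move=> t /andP[t0 tm]; rewrite powR_sqr.
have t1 : 0 <= t / m <= 1 by rewrite divr_ge0 ?(ltW m0) //= ler_pdivrMr // mul1r.
have := ler_wpM2l (powR_ge0 m (2 * nu)) (hC _ t1).
have -> : m `^ (2 * nu) * (t / m) `^ (2 * nu) = t `^ (2 * nu).
  rewrite -powRM ?(ltW m0) //; last by case/andP: t1.
  by rewrite mulrC divfK // gt_eqF.
move=> {}h; rewrite -subr_ge0 in h; apply: le_trans h _.
by apply: eq_imply_le; ring.
Qed.
End SpectralEstimates.

(** * The least squares functional *)

Section LeastSquares.
Context {R : realType} {X Y : hilbertType R} (A : {linear X -> Y}) (y : Y).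
Hypothesis cA : continuous A.
Let yd := data_proj A y.
Let f := least_squares A y.

Lemma data_proj_range : closure (range A) yd.
Proof. exact: (data_projP A y).1. Qed.

Lemma adjoint_eq0 z : (adjoint A z = 0) <-> (forall x, inner z (A x) = 0).
Proof.
split=> [z0 x|z0]; first by rewrite innerC adjointP // z0 inner0r.
by apply: inner_eq0 => x; rewrite innerC -adjointP // innerC z0.
Qed.

Lemma closure_range_adjoint_eq0 z :
  closure (range A) z -> adjoint A z = 0 -> z = 0.
Proof.
move=> zA /adjoint_eq0 z0; apply/eqP; rewrite -normr_eq0 -sqrf_eq0 -inner_norm.
by rewrite (inner_closure0 _ zA) // => _ [x _ <-].
Qed.

Lemma closure_rangeP a u v :
  closure (range A) u -> closure (range A) v -> closure (range A) (a *: u + v).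
Proof.
move=> /closure_approx uA /closure_approx vA; apply/closure_approx => e e0.
have e1 : 0 < e / 2 / (`|a| + 1) by rewrite !divr_gt0 // ltr_wpDl.
have [_ [x1 _ <-] u1] := uA _ e1.
have [_ [x2 _ <-] v2] := vA _ (divr_gt0 e0 (ltr0n R 2)).
exists (A (a *: x1 + x2)); first by exists (a *: x1 + x2).
rewrite linearP opprD addrACA -scalerBr; apply: le_lt_trans (ler_normD _ _) _.
rewrite normrZ [e in ltRHS]splitr; apply: ler_ltD v2.
apply: le_trans (_ : (`|a| + 1) * `|u - A x1| <= _).
  by rewrite ler_wpM2r // lerDl.
by rewrite mulrC -ler_pdivlMr ?ltW // ltr_wpDl.
Qed.

Lemma least_squares_split x :
  f x = 2^-1 * `|A x - yd| ^+ 2 + 2^-1 * `|y - yd| ^+ 2.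
Proof.
have : inner (y - yd) (A x - yd) = 0.
  apply: (data_projP A y).2; rewrite addrC -scaleN1r; apply: closure_rangeP.
    exact: data_proj_range.
  by apply: subset_closure; exists x.
rewrite /f /least_squares => yA0.
have -> : A x - y = (A x - yd) - (y - yd) by rewrite opprB addrA subrK.
by rewrite (sqr_normB (A x - yd)) (innerC (A x - yd)) yA0; ring.
Qed.

Lemma inf_least_squares : inf (range f) = 2^-1 * `|y - yd| ^+ 2.
Proof.
set c := 2^-1 * _.
have fc x : c <= f x by rewrite least_squares_split lerDr mulr_ge0 ?sqr_ge0.
have lb : has_lbound (range f) by exists c => _ [x _ <-].
apply/le_anti/andP; split; last first.
  by apply: lb_le_inf; [exists (f 0), 0|move=> _ [x _ <-]].
apply/ler_addgt0Pr => e e0.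
have e1 : 0 < Num.sqrt (2 * e) by rewrite sqrtr_gt0 mulr_gt0.
have /closure_approx/(_ _ e1)[_ [x _ <-] xe] := data_proj_range.
apply: le_trans (_ : f x <= _); first by apply: ge_inf => //; exists x.
rewrite least_squares_split addrC lerD2l distrC.
have : `|yd - A x| ^+ 2 <= Num.sqrt (2 * e) ^+ 2.
  by rewrite ler_sqr ?nnegrE // ltW.
by rewrite sqr_sqrtr ?mulr_ge0 ?(ltW e0) // => ?; lra.
Qed.

Lemma least_squares_gap x : f x - inf (range f) = 2^-1 * `|A x - yd| ^+ 2.
Proof. by rewrite inf_least_squares least_squares_split addrK. Qed.

Lemma gradient_least_squares x : gradient f x = adjoint A (A x - yd).
Proof.
have [K K0 AK] := continuous_linear_le cA.
have -> : adjoint A (A x - yd) = adjoint A (A x - y).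
  apply/subr0_eq; rewrite -[LHS]addrC -scaleN1r -adjoint_linear // scaleN1r.
  rewrite opprB addrA subrK; apply/adjoint_eq0 => z.
  by apply: (data_projP A y).2; apply: subset_closure; exists z.
set G := adjoint A (A x - y).
have lin : linear (fun h => inner G h : R^o).
  by move=> a u v; rewrite innerDr innerZr.
pose linM := GRing.isLinear.Build _ _ _ _ _ lin.
pose L : {linear X -> R^o} := HB.pack (fun h => inner G h : R^o) linM.
have cL : continuous L.
  apply: bounded_linear_continuous; apply/linear_boundedP.
  near=> r => h; apply: le_trans (cauchy_schwarz _ _) _.
  by rewrite ler_wpM2r //; near: r; exact: nbhs_pinfty_ge.
have dfo : (f : X -> R^o) \o shift x = cst (f x : R^o) + L +o_ (0 : X) id.
  apply/eqaddoP => _/posnumP[e].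
  have e2 : 0 < e%:num / K ^+ 2 by rewrite divr_gt0 // exprn_gt0.
  near=> h.
  have -> : ((f : X -> R^o) \o shift x - (cst (f x : R^o) + L)) h = 2^-1 * `|A h| ^+ 2.
    have E : f (h + x) - (f x + inner G h) = 2^-1 * `|A h| ^+ 2.
      rewrite /f /least_squares linearD /=.
      have -> : A h + A x - y = A h + (A x - y) by rewrite addrA.
      by rewrite (sqr_normD (A h)) (innerC G) /G -adjointP //; field.
    exact: E.
  rewrite ger0_norm ?mulr_ge0 ?sqr_ge0 //=.
  have hK : `|h| <= e%:num / K ^+ 2.
    by near: h; apply: nbhs0_le.
  have Ah : `|A h| ^+ 2 <= (K * `|h|) ^+ 2 by rewrite ler_sqr ?nnegrE // mulr_ge0 // ltW.
  apply: le_trans (_ : (K * `|h|) ^+ 2 <= _).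
    by apply: le_trans Ah; rewrite ler_piMl ?sqr_ge0 // invf_le1 // ler1n.
  rewrite exprMn expr2 [_ ^+ 2 in leLHS]expr2 mulrA ler_wpM2r //.
  by rewrite -expr2 mulrC -ler_pdivlMr // exprn_gt0.
have dE := diff_unique cL dfo.
have df : differentiable (f : X -> R^o) x by apply/diff_locallyP; rewrite dE.
pose P := [set g | differentiable (f : X -> R^o) x /\
  forall h, 'd (f : X -> R^o) x h = inner g h].
have [_ gE] : P (gradient f x).
  by apply: (@getPex _ P); exists G; split => // h; rewrite dE.
by apply: inner_inj => h; rewrite -gE dE.
Unshelve. all: by end_near. Qed.

Lemma douglas_range u K : (forall v, `|inner u v| <= K * `|adjoint A v|) ->
  range A u.
Proof.
move=> uK; pose linM := GRing.isLinear.Build _ _ _ _ _ (adjoint_linear cA).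
pose B : {linear Y -> X} := HB.pack (adjoint A) linM.
have [x _ xu] := riesz_range (B := B) (scalar_inner idfun u) uK.
exists x => //; apply: inner_inj => v; rewrite adjointP //; exact: xu.
Qed.
End LeastSquares.

(** * The operator A o adjoint A *)

Section Gram.
Context {R : realType} {X Y : hilbertType R} (A : {linear X -> Y}).
Hypothesis cA : continuous A.

Lemma gram_linear : linear (A \o adjoint A).
Proof. by move=> a u v; rewrite /= adjoint_linear // linearP. Qed.

Definition gram : {linear Y -> Y} :=
  HB.pack (A \o adjoint A) (GRing.isLinear.Build _ _ _ _ _ gram_linear).

Lemma inner_gram u v : inner (gram u) v = inner (adjoint A u) (adjoint A v).
Proof. exact: (adjointP cA). Qed.

Lemma gram_sym u v : inner (gram u) v = inner u (gram v).
Proof. by rewrite inner_gram innerC -inner_gram innerC. Qed.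

Lemma gram_ge0 u : 0 <= inner (gram u) u.
Proof. by rewrite inner_gram inner_norm sqr_ge0. Qed.

Lemma gram_bounded : exists K : R, forall w, `|gram w| <= K * `|w|.
Proof.
have [K K0 AK] := continuous_linear_le cA; exists (K * K) => w /=.
apply: le_trans (AK _) _; rewrite -mulrA ler_wpM2l ?(ltW K0) //.
exact: norm_adjoint_le.
Qed.

(** T and adjoint A have the same kernel, so the orthogonal projection of w
onto the closure of the range of T differs from w by a vector of the closure of
range A that adjoint A kills. *)
Lemma closure_range_gram w : closure (range A) w -> closure (range gram) w.
Proof.
move=> wA; have wK v : `|inner w (gram v)| <= `|w| * `|gram v|.
  exact: cauchy_schwarz.
have [z zT zw] := riesz_range (scalar_inner gram w) wK.
have TA : range gram `<=` range A.
  by move=> _ [v _ <-]; exists (adjoint A v).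
have zA : closure (range A) z by apply: closure_subset zT.
suff -> : w = z by [].
apply/subr0_eq/(closure_range_adjoint_eq0 cA).
  by rewrite addrC -scaleN1r; apply: closure_rangeP.
apply/eqP; rewrite -normr_eq0 -sqrf_eq0 -inner_norm -inner_gram gram_sym.
by rewrite innerBl zw subrr.
Qed.

(** For u in the closure, <u, v> only depends on the projection of v onto that
closure, where |v| is controlled by |adjoint A v|; so [douglas_range]
applies. *)
Lemma bounded_below_closed_range (e : R) : 0 < e ->
  (forall u, closure (range A) u -> e * `|u| ^+ 2 <= `|adjoint A u| ^+ 2) ->
  closed (range A).
Proof.
move=> e0 lbA; rewrite closure_id; apply/seteqP; split; first exact: subset_closure.
move=> u uA; apply: (@douglas_range _ _ _ A cA u (`|u| / Num.sqrt e)) => v.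
have [Pv Pv0] := data_projP A v.
set z := data_proj A v in Pv Pv0.
have -> : inner u v = inner u z.
  by apply/subr0_eq; rewrite -innerBr innerC; apply: Pv0.
have -> : adjoint A v = adjoint A z.
  apply/subr0_eq; rewrite addrC -scaleN1r -adjoint_linear // scaleN1r addrC.
  by apply/adjoint_eq0 => // x; apply: Pv0; apply: subset_closure; exists x.
apply: le_trans (cauchy_schwarz _ _) _; rewrite -mulrA ler_wpM2l //.
rewrite mulrC ler_pdivlMr ?sqrtr_gt0 // mulrC.
rewrite -ler_sqr ?nnegrE ?mulr_ge0 ?sqrtr_ge0 // exprMn sqr_sqrtr ?(ltW e0) //.
exact: lbA.
Qed.

End Gram.

(** * Source conditions *)

Section SourceSets.
Context {R : realType} {X Y : hilbertType R} (A : {linear X -> Y}) (y : Y).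
Hypothesis cA : continuous A.
Variable nu : R.
Hypothesis nu0 : 0 < nu.
Let yd := data_proj A y.
Let f := least_squares A y.
Let T := gram cA.
Let M := opnorm T.
Let S := op_power (A \o adjoint A) nu.

Let Tsym := gram_sym cA.
Let Tpos := gram_ge0 cA.
Let M0 : 0 <= M := opnorm_ge0 (gram_bounded cA).
Let TM : forall u, inner (T u) u <= M * `|u| ^+ 2 := inner_le_opnorm (gram_bounded cA).

Lemma op_power_approx : op_approx T M (fun t => t `^ nu) S.
Proof.
apply: (fun_calculus_approx (gram_bounded cA) Tsym Tpos).
apply: powR_within_continuous => //.
by rewrite ltr_wpDl // (opnorm_ge0 (gram_bounded cA)).
Qed.

Lemma op_power_gap x w : A x = yd + S w ->
  f x - inf (range f) = 2^-1 * `|S w| ^+ 2 /\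
  `|gradient f x| = `|adjoint A (S w)|.
Proof.
move=> xw; rewrite least_squares_gap // gradient_least_squares // xw.
by rewrite addrC addKr.
Qed.

(** The range of T to the power 1/2 is the range of A; the exponent being larger,
[douglas_range] applies because |S v|^2 is at most a multiple of <T v, v>. *)
Lemma op_power_range : 1 / 2 < nu -> forall w, range A (S w).
Proof.
move=> nu2 w.
pose K := Num.sqrt (M `^ (2 * nu - 1)).
apply: (douglas_range cA (K := `|w| * K)) => v.
rewrite (op_approx_sym Tsym op_power_approx).
apply: le_trans (cauchy_schwarz _ _) _; rewrite -mulrA ler_wpM2l //.
rewrite -ler_sqr ?nnegrE ?mulr_ge0 ?sqrtr_ge0 // exprMn sqr_sqrtr ?powR_ge0 //.
have MM : 0 <= M <= M by rewrite M0 lexx.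
have sM : spectral_bound T M v by move=> q; apply: TM.
have := @op_approx_ge0 _ _ T M Tsym Tpos M0 TM _ S (-1) 0 0 (M `^ (2 * nu - 1)) M v
  op_power_approx MM sM.
rewrite !inner_gram !inner_norm => h; rewrite -subr_ge0.
apply: le_trans (h _) _; last first.
  by apply: eq_imply_le; ring.
move=> t /andP[t0 tM]; rewrite !mul0r !addr0 mulN1r addrC subr_ge0.
have nu1 : 0 < 2 * nu by rewrite mulr_gt0.
rewrite -powR_mulrn ?powR_ge0 // -powRrM (mulrC nu) [leRHS]mulrC.
rewrite -(mulr_powRB1 t0 nu1) ler_wpM2l //.
by apply: ge0_ler_powR; rewrite ?nnegrE //; lra.
Qed.

(** [power_interpolation] with the optimal r, namely the one for which
r^(2 nu + 1) is the quotient of the moments of orders 2 nu + 1 and 0 of w. *)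
Lemma op_power_lojasiewicz w (delta th : R) : th = (2 * nu + 1) / (4 * nu) ->
  0 < delta -> `|w| <= delta -> closure (range A) (S w) ->
  (2^-1 * `|S w| ^+ 2) `^ th <=
    2 `^ (- th) * delta `^ (1 / (2 * nu)) * `|adjoint A (S w)|.
Proof.
move=> thE d0 wd SA.
have th0 : 0 < th by rewrite thE divr_gt0 ?addr_gt0 ?mulr_gt0.
have [Sw0|SwN0] := eqVneq (S w) 0.
  rewrite Sw0 normr0 expr0n mulr0 powR0 ?gt_eqF //.
  by rewrite !mulr_ge0 ?powR_ge0.
have B0 : 0 < `|adjoint A (S w)|.
  rewrite normr_gt0; apply/eqP => h; move/eqP : SwN0; apply.
  exact: (closure_range_adjoint_eq0 cA).
have D0 : 0 < `|w|.
  rewrite normr_gt0; apply/eqP => h; move/eqP : SwN0; apply.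
  have := op_approx_linear op_power_approx (-1) 0 0.
  by rewrite h scaler0 addr0 scaleN1r addNr.
have a0 : 0 < 2 * nu by rewrite mulr_gt0.
have a1 : 0 < 2 * nu + 1 by rewrite addr_gt0.
pose r := (`|adjoint A (S w)| / `|w|) `^ (2 / (2 * nu + 1)).
have r0 : 0 < r by rewrite powR_gt0 // divr_gt0.
have rE : r * r `^ (2 * nu) = (`|adjoint A (S w)| / `|w|) ^+ 2.
  have -> : r * r `^ (2 * nu) = r `^ (2 * nu + 1).
    by rewrite -(mulr_powRB1 (ltW r0) a1) addrK.
  rewrite /r -powRrM divfK ?gt_eqF // powR_mulrn // divr_ge0.
have := power_interpolation Tsym Tpos M0 TM nu0 op_power_approx w r0.
rewrite inner_gram inner_norm.
have -> : 2 * nu / (2 * nu + 1) / r * `|adjoint A (S w)| ^+ 2 =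
   2 * nu / (2 * nu + 1) * (r `^ (2 * nu) * `|w| ^+ 2).
  have -> : `|adjoint A (S w)| ^+ 2 = r * r `^ (2 * nu) * `|w| ^+ 2.
    by rewrite rE exprMn exprVn mulrVK // unitfE expf_neq0 // gt_eqF.
  by field; rewrite !gt_eqF.
have -> : 2 * nu / (2 * nu + 1) * (r `^ (2 * nu) * `|w| ^+ 2) +
  r `^ (2 * nu) / (2 * nu + 1) * `|w| ^+ 2 = r `^ (2 * nu) * `|w| ^+ 2.
  by field; rewrite gt_eqF.
move=> h.
have two0 : 0 <= 2^-1 :> R by rewrite invr_ge0.
apply: le_trans (_ : (2^-1 * (r `^ (2 * nu) * `|w| ^+ 2)) `^ th <= _).
  apply: ge0_ler_powR; rewrite ?nnegrE ?mulr_ge0 ?sqr_ge0 ?powR_ge0 ?(ltW th0) //.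
  by rewrite ler_wpM2l.
rewrite !powRM ?mulr_ge0 ?sqr_ge0 ?powR_ge0 //.
have -> : (2^-1 : R) `^ th = 2 `^ (- th).
  by rewrite -powR_inv1 // -powRrM mulN1r.
rewrite -!mulrA ler_wpM2l ?powR_ge0 //.
have -> : (r `^ (2 * nu)) `^ th = `|adjoint A (S w)| / `|w|.
  rewrite -!powRrM.
  have -> : 2 / (2 * nu + 1) * (2 * nu * th) = 1.
    by rewrite thE; field; rewrite !gt_eqF.
  by rewrite powRr1 // divr_ge0.
rewrite -powRD ?(gt_eqF D0) ?implybT //.
have -> : th + th = 1 / (2 * nu) + 1 by rewrite thE; field; rewrite gt_eqF.
rewrite powRD ?(gt_eqF D0) ?implybT // powRr1 // mulrC.
have -> : `|w| `^ (1 / (2 * nu)) * `|w| * (`|adjoint A (S w)| / `|w|) =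
   `|w| `^ (1 / (2 * nu)) * `|adjoint A (S w)| by field; rewrite gt_eqF.
rewrite ler_wpM2r //; apply: ge0_ler_powR; rewrite ?nnegrE ?(ltW d0) //.
by rewrite divr_ge0 // ltW.
Qed.

(** The admissible v include w0 + T z for every z, because S (T z) = T (S z) lies in
the range of A.  These are dense in the closure of range A, and both sides are
continuous in v away from the kernel of S. *)
Lemma source_inequality_closure w0 (delta th c : R) :
  closure (range A) w0 -> range A (yd + S w0) ->
  (forall v, closure (range A) v -> `|v| <= delta -> S v != 0 ->
     range A (yd + S v) -> (2^-1 * `|S v| ^+ 2) `^ th <= c * `|adjoint A (S v)|) ->
  forall w, closure (range A) w -> `|w| < delta -> S w != 0 ->
    (2^-1 * `|S w| ^+ 2) `^ th <= c * `|adjoint A (S w)|.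
Proof.
move=> w0A [x0 _ x0E] ineq w wA wd SwN0.
have linS := op_approx_linear op_power_approx.
pose SL : {linear Y -> Y} := HB.pack S (GRing.isLinear.Build _ _ _ _ _ linS).
have [K [K0 _ SK]] := op_approx_bounded Tsym Tpos M0 TM op_power_approx.
have cS : continuous S.
  apply: (bounded_linear_continuous (f := SL)); apply/linear_boundedP.
  near=> r => h; apply: le_trans (SK h) _.
  by rewrite ler_wpM2r //; near: r; exact: nbhs_pinfty_ge.
pose AL : {linear Y -> X} :=
  HB.pack (adjoint A) (GRing.isLinear.Build _ _ _ _ _ (adjoint_linear cA)).
have cAd : continuous (adjoint A).
  have [L L0 AL'] := continuous_linear_le cA.
  apply: (bounded_linear_continuous (f := AL)); apply/linear_boundedP.
  near=> r => h; apply: le_trans (norm_adjoint_le cA L0 AL' h) _.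
  by rewrite ler_wpM2r //; near: r; exact: nbhs_pinfty_ge.
have nS : (fun v => `|S v|) v @[v --> w] --> `|S w|.
  by apply: cvg_norm; exact: cS.
have nA : `|adjoint A (S v)| @[v --> w] --> `|adjoint A (S w)|.
  apply: cvg_norm; apply: (@continuous_comp _ _ _ S (adjoint A)); first exact: cS.
  exact: cAd.
have Sw0 : 0 < `|S w| by rewrite normr_gt0.
have nP : (2^-1 * `|S v| ^+ 2) `^ th @[v --> w] --> (2^-1 * `|S w| ^+ 2) `^ th.
  have base0 : 0 < 2^-1 * `|S w| ^+ 2 by rewrite mulr_gt0 ?exprn_gt0 // invr_gt0.
  have pc : {for 2^-1 * `|S w| ^+ 2, continuous (fun t : R => t `^ th)}.
    apply: differentiable_continuous.
    by apply/derivable1_diffP/derivable_powR; rewrite in_itv /= base0.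
  have bc : 2^-1 * `|S v| ^+ 2 @[v --> w] --> 2^-1 * `|S w| ^+ 2.
    by apply: cvgM; [exact: cvg_cst|exact: cvgM].
  exact: (continuous_cvg (nbhs_filter w) pc bc).
rewrite leNgt; apply/negP => gap.
have cvgap : (2^-1 * `|S v| ^+ 2) `^ th - c * `|adjoint A (S v)| @[v --> w] -->
    (2^-1 * `|S w| ^+ 2) `^ th - c * `|adjoint A (S w)|.
  by apply: cvgB => //; apply: cvgM => //; exact: cvg_cst.
have gap0 : \forall v \near w,
    0 < (2^-1 * `|S v| ^+ 2) `^ th - c * `|adjoint A (S v)|.
  by apply: (cvgr_gt _ cvgap); rewrite subr_gt0.
have Sv0 : \forall v \near w, 0 < `|S v| by apply: (cvgr_gt _ nS).
have nv : \forall v \near w, `|v| < delta.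
  by apply: (cvgr_lt `|w|) => //; apply: cvg_norm; exact: cvg_id.
have [e /= e0 eP] := iffLR (nbhs_ballP _ _) (filterI gap0 (filterI Sv0 nv)).
have ww0 : closure (range T) (w - w0).
  apply: closure_range_gram => //.
  by rewrite addrC -scaleN1r; apply: closure_rangeP.
have [_ [z _ <-] wz] := iffLR (closure_approx _ _) ww0 e e0.
have [|/= gapv [Svp vd]] := eP (w0 + T z).
  by rewrite -ball_normE /= opprD addrA.
move: gapv; rewrite subr_gt0 ltNge => /negP; apply.
apply: ineq.
- rewrite addrC -[A _]scale1r; apply: closure_rangeP => //.
  by apply: subset_closure; exists (adjoint A z).
- exact: ltW.
- by rewrite -normr_gt0.
exists (x0 + adjoint A (S z)) => //.
rewrite linearD x0E -addrA; congr (_ + _).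
have -> : A (adjoint A (S z)) = S (A (adjoint A z)).
  exact: (op_approx_comm Tsym Tpos M0 TM op_power_approx).
exact: (esym (linearD SL _ _)).
Unshelve. all: by end_near. Qed.

(** The assumed inequality is tested at k * delta times a unit vector of the range
of Q whose Rayleigh quotient is so close to its supremum m that [power_ge] loses
at most a factor k; then k tends to 1. *)
Lemma inequality_at_spectral_edge (Q : {linear Y -> Y}) (delta th c e : R) :
  (forall w, closure (range A) w -> `|w| < delta -> S w != 0 ->
    (2^-1 * `|S w| ^+ 2) `^ th <= c * `|adjoint A (S w)|) ->
  0 < delta -> 0 <= th -> 0 < c ->
  (forall v, T (Q v) = Q (T v)) -> (forall v, range A (Q v)) ->
  (exists v, Q v != 0) -> e <= M ->
  (forall v, inner (T (Q v)) (Q v) <= e * `|Q v| ^+ 2) ->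
  exists m, 0 < m <= e /\
    (2^-1 * delta ^+ 2 * m `^ (2 * nu)) `^ th <= c * delta * Num.sqrt (m * m `^ (2 * nu)).
Proof.
move=> ineq d0 th0 c0 TQ QA [v0 Qv0] eM Qe.
have [|m [m0 me um near_m]] := near_eigenvector TQ Qe.
  exists v0; rewrite inner_gram inner_norm exprn_gt0 // normr_gt0.
  apply/eqP => h; move/eqP : Qv0; apply.
  by apply: (closure_range_adjoint_eq0 cA) => //; exact: subset_closure.
have mM : 0 < m <= M by rewrite m0 (le_trans me).
exists m; split; first by rewrite m0.
have [C C0 hC] := power_ge Tsym Tpos M0 TM nu0 op_power_approx.
have mnu : 0 < m `^ (2 * nu) by rewrite powR_gt0.
have linS := op_approx_linear op_power_approx.
pose SL : {linear Y -> Y} := HB.pack S (GRing.isLinear.Build _ _ _ _ _ linS).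
(* one factor k comes from [power_ge], two from the square of k * delta *)
apply: (@powR_limit1 _ (3 * th)); rewrite ?mulr_ge0 ?powR_ge0 //.
move=> k /andP[k0 k1].
have C1 : 0 < C + 1 by rewrite ltr_wpDl.
(* with this Rayleigh quotient [power_ge] bounds |S (Q v)|^2 below by m^(2 nu) k *)
have [|v [v1 vm]] := near_m (1 - (1 - k) / (C + 1)).
  by rewrite ltrBlDr ltrDl divr_gt0 // subr_gt0.
have Su : m `^ (2 * nu) * k <= `|S (Q v)| ^+ 2.
  apply: le_trans (hC m (Q v) mM (um v)); rewrite ler_pM2l // v1 expr1n mulr1.
  have : (1 - (1 - k) / (C + 1)) * (C / m * m) <= C / m * inner (T (Q v)) (Q v).
    apply: le_trans (ler_wpM2l (divr_ge0 C0 (ltW m0)) vm).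
    by rewrite [leLHS]mulrCA.
  rewrite divfK ?gt_eqF // => h.
  rewrite -lerBlDl; apply: le_trans h.
  have : C / (C + 1) <= 1 by rewrite ler_pdivrMr // mul1r lerDl.
  have -> : (1 - (1 - k) / (C + 1)) * C = C - (1 - k) * (C / (C + 1)) by ring.
  move: (C / (C + 1)) => r r1; nra.
have kd : 0 < k * delta by rewrite mulr_gt0.
have SwE : S ((k * delta) *: Q v) = (k * delta) *: S (Q v) by exact: (linearZZ SL).
have SuN0 : S (Q v) != 0.
  apply/eqP => S0; have := lt_le_trans (mulr_gt0 mnu k0) Su.
  by rewrite S0 normr0 expr0n ltxx.
have := ineq ((k * delta) *: Q v).
rewrite SwE => /(_ _ _ _) h.
have {}h : (2^-1 * `|(k * delta) *: S (Q v)| ^+ 2) `^ th <=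
    c * `|adjoint A ((k * delta) *: S (Q v))|.
  apply: h.
  - rewrite -[_ *: _]addr0; apply: closure_rangeP => //; apply: subset_closure => //.
    by exists 0 => //; exact: linear0.
  - by rewrite normrZ v1 mulr1 gtr0_norm // gtr_pMl.
  - by rewrite scaler_eq0 negb_or SuN0 gt_eqF.
have As : `|adjoint A (S (Q v))| <= Num.sqrt (m * m `^ (2 * nu)).
  rewrite -[leLHS]ger0_norm // -sqrtr_sqr ler_sqrt; last first.
    by rewrite mulr_ge0 ?powR_ge0 // ltW.
  have := power_le Tsym Tpos M0 TM nu0 op_power_approx mM (um v).
  by rewrite v1 expr1n mulr1 inner_gram inner_norm.
have AsE : adjoint A ((k * delta) *: S (Q v)) = (k * delta) *: adjoint A (S (Q v)).
  have := adjoint_linear cA (k * delta) (S (Q v)) 0.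
  have A0 : adjoint A 0 = 0 by apply/(adjoint_eq0 cA) => x; rewrite inner0l.
  by rewrite !addr0 A0 addr0.
rewrite AsE !(normrZ (k * delta)) (gtr0_norm kd) in h.
apply: le_trans (_ : c * (k * delta * `|adjoint A (S (Q v))|) <= _); last first.
  rewrite -[leRHS]mulrA ler_wpM2l ?(ltW c0) //; apply: ler_pM => //; first exact: ltW.
  by rewrite ler_piMl ?(ltW d0) // ltW.
apply: le_trans h.
have E : k `^ (3 * th) = (k ^+ 3) `^ th.
  by rewrite powRrM powR_mulrn // ltW.
rewrite E -powRM ?exprn_ge0 ?(ltW k0) //
  ?mulr_ge0 ?(ltW mnu) ?sqr_ge0 ?invr_ge0 ?(ltW d0) //.
apply: ge0_ler_powR => //;
  rewrite ?nnegrE ?mulr_ge0 ?exprn_ge0 ?(ltW k0) ?(ltW mnu) ?invr_ge0 ?(ltW d0) //.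
rewrite exprMn.
have -> : k ^+ 3 * (2^-1 * delta ^+ 2 * m `^ (2 * nu)) =
   2^-1 * ((k * delta) ^+ 2 * (m `^ (2 * nu) * k)) by ring.
by rewrite ler_wpM2l ?invr_ge0 // ler_wpM2l ?sqr_ge0.
Qed.

(** Q is T times the cutoff k(T), with k t = max(0, 1 - t / e), whose range lives on
the spectrum in [0, e].  If Q vanished, so would k(T) on the closure of range A,
and 1 - 2 t / e <= (k t)^2 would bound adjoint A from below there, which forces
range A to be closed. *)
Lemma small_spectrum (e : R) : 0 < e -> ~ closed (range A) ->
  exists Q : {linear Y -> Y}, [/\ forall v, T (Q v) = Q (T v),
    forall v, range A (Q v), exists v, Q v != 0 &
    forall v, inner (T (Q v)) (Q v) <= e * `|Q v| ^+ 2].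
Proof.
move=> e0 nclosed; pose k (t : R) := Num.max 0 (1 - t / e).
have ck : {within `[0, M + 1], continuous k}.
  apply: continuous_subspaceT => t.
  apply: (@continuous_max R R (fun=> 0) (fun t => 1 - t / e)); first exact: cvg_cst.
  by apply: cvgB; [exact: cvg_cst|apply: cvgM => //; exact: cvg_cst].
have [F [linF hF _]] := op_approx_exists Tsym Tpos M0 TM ck.
have FT v : T (F v) = F (T v) by exact: (op_approx_comm Tsym Tpos M0 TM hF).
have linQ : linear (fun v => F (T v)) by move=> a u v; rewrite linearP linF.
pose Q : {linear Y -> Y} :=
  HB.pack (fun v => F (T v)) (GRing.isLinear.Build _ _ _ _ _ linQ).
have QE v : Q v = T (F v) by rewrite FT.
exists Q.
have MM : 0 <= M <= M by rewrite M0 lexx.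
have sM u : spectral_bound T M u by move=> q; apply: TM.
have kt t : 0 <= t -> k t = if t <= e then 1 - t / e else 0.
  move=> t0; rewrite /k; case: ifP => te.
    by rewrite max_r // subr_ge0 ler_pdivrMr // mul1r.
  rewrite max_l // subr_le0 ler_pdivlMr // mul1r ltW // ltNge te //.
split=> [v|v||v].
- by rewrite !QE FT.
- by rewrite QE; exists (adjoint A (F v)).
- apply: contrapT => Q0.
  have {}Q0 v : T (F v) = 0.
    by apply: contrapT => Tv; apply: Q0; exists v; rewrite QE; apply/eqP.
  apply: nclosed; apply: (bounded_below_closed_range cA (e := e / 2)).
    exact: divr_gt0.
  move=> u uA; have Fu : F u = 0.
    apply: inner_eq0 => v; rewrite (op_approx_sym Tsym hF) innerC.
    apply: (inner_closure0 _ uA) => _ [x _ <-]; move: x; apply/(adjoint_eq0 cA).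
    apply/eqP; rewrite -normr_eq0 -sqrf_eq0 -inner_norm -inner_gram.
    by rewrite [gram cA _]Q0 inner0l.
  have := @op_approx_ge0 _ _ T M Tsym Tpos M0 TM _ F 1 0 (-1) (2 / e) M u hF MM (sM u).
  rewrite Fu normr0 expr0n !inner_gram !inner_norm => h.
  have {h} : 0 <= - `|u| ^+ 2 + 2 / e * `|adjoint A u| ^+ 2.
    apply: le_trans (h _) _; last by rewrite !(mulr0, mul0r) !add0r mulN1r.
    move=> t /andP[t0 _]; rewrite kt //; case: ifP => te.
      have -> : 1 * (1 - t / e) ^+ 2 + 0 * (t * (1 - t / e) ^+ 2) + -1 + 2 / e * t =
        (t / e) ^+ 2 by field; rewrite gt_eqF.
      exact: sqr_ge0.
    rewrite expr0n !(mulr0, mul0r) !add0r addrC subr_ge0 mulrAC ler_pdivlMr // mul1r.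
    by move: te => /negbT; rewrite -ltNge; lra.
  rewrite addrC subr_ge0 => h; rewrite -ler_pdivlMl ?divr_gt0 //.
  by rewrite invf_div.
rewrite QE FT.
have := @op_approx_ge0 _ _ T M Tsym Tpos M0 TM _ F e (-1) 0 0 M (T v) hF MM (sM _).
rewrite !mul0r !addr0 mulN1r subr_ge0; apply.
move=> t /andP[t0 _]; rewrite kt // !addr0 mul0r addr0 mulN1r -mulrBl.
case: ifP => te; last by rewrite expr0n !mulr0.
by rewrite mulr_ge0 ?sqr_ge0 // subr_ge0.
Qed.
End SourceSets.

(** * The Lojasiewicz inequality on source sets *)

Unset Implicit Arguments.

(* Sharpness. The constant is the least possible as soon as the inequality is
   not vacuous. As to p, exponents are compared through 1 - 1/p (a smaller power
   is a stronger inequality near the minimal value); closed ranges have to be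
   excluded, since then f is 2-Lojasiewicz on the whole space. *)
Theorem theorem5p9 (R : realType) (X Y : hilbertType R) (A : {linear X -> Y})
    (hA : continuous A) (y : Y) (mu delta : R)
    (hmu : - 2^-1 < mu) (hmu0 : mu != 0) (hdelta : 0 < delta) :
  let f := least_squares A y in
  let Omega := source_set A y mu delta in
  let p := 2 + mu^-1 in
  let c := 2 `^ (- ((mu + 1) / (2 * mu + 1))) * delta `^ (1 / (1 + 2 * mu)) in
  [/\ (* an inadmissible p (mu > 0, argmin f empty) forces Omega to be empty *)
      Omega !=set0 -> lojasiewicz_exponent f p,
      lojasiewicz_with f p Omega c,
      Omega `\` argmin f !=set0 ->
        forall c', lojasiewicz_with f p Omega c' -> c <= c'
    & Omega `\` argmin f !=set0 -> ~ closed (range A) ->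
        forall p', lojasiewicz f p' Omega -> 1 - p^-1 <= 1 - p'^-1].
Proof.
move=> f Omega p c.
pose nu := mu + 2^-1.
have nu0 : 0 < nu by rewrite /nu; lra.
pose S := op_power (A \o adjoint A) nu.
pose yd := data_proj A y.
have OmegaP x : Omega x <-> exists w, [/\ closure (range A) w, `|w| <= delta &
    A x = yd + S w].
  split=> [[w [wA wd] /esym wx]|[w [wA wd /esym wx]]]; first by exists w.
  by exists w.
have mu1 : 0 < 2 * mu + 1 by lra.
have f_ge0 x : 0 <= f x by rewrite /f /least_squares mulr_ge0 // sqr_ge0.
have lbf : has_lbound (range f) by exists 0 => _ [x _ <-].
have pE : 1 - p^-1 = (2 * nu + 1) / (4 * nu).
  have p0 : 2 * mu + 1 != 0 by rewrite gt_eqF.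
  have -> : p = (2 * mu + 1) / mu by rewrite /p; field.
  rewrite /nu; field; apply/andP; split => //.
  by rewrite mulrC.
set th := 1 - p^-1 in pE *.
have th0 : 0 < th by rewrite pE divr_gt0 ?addr_gt0 ?mulr_gt0.
have cE : c = 2 `^ (- th) * delta `^ (1 / (2 * nu)).
  by rewrite /c pE /nu; congr (_ `^ (- _) * _ `^ _); field; rewrite ?gt_eqF //; lra.
have min_gap x : argmin f x -> f x - inf (range f) <= 0.
  move=> xmin; rewrite subr_le0; apply: lb_le_inf; first by exists (f 0), 0.
  by move=> _ [z _ <-].
have loj_source c' p' : lojasiewicz_with f p' Omega c' ->
    forall v, closure (range A) v -> `|v| <= delta -> S v != 0 ->
    range A (yd + S v) ->
    (2^-1 * `|S v| ^+ 2) `^ (1 - p'^-1) <= c' * `|adjoint A (S v)|.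
  move=> [_ loj] v vA vd Sv [x _ xv].
  have [gap grad] := op_power_gap hA xv.
  have := loj x; rewrite gap grad; apply; split.
    by apply/OmegaP; exists v.
  move=> /min_gap; rewrite gap leNgt => /negP; apply.
  by rewrite mulr_gt0 ?invr_gt0 ?exprn_gt0 ?normr_gt0.
have nonmin x : (Omega `\` argmin f) x -> exists w, [/\ closure (range A) w,
    range A (yd + S w) & S w != 0].
  move=> [/OmegaP[w [wA wd xw]] xmin]; exists w; split => //; first by exists x.
  apply/eqP => Sw; apply: xmin => z.
  rewrite /f !(least_squares_split A) xw Sw addr0 subrr normr0 expr0n mulr0 add0r.
  by rewrite lerDr mulr_ge0 // sqr_ge0.
have edge_inequalityE c' t m : 0 < m ->
    ((2^-1 * delta ^+ 2 * m `^ (2 * nu)) `^ t <=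
      c' * delta * Num.sqrt (m * m `^ (2 * nu))) =
    ((2^-1 * delta ^+ 2) `^ t * m `^ (2 * nu * t) <= c' * delta * m `^ (2 * nu * th)).
  move=> m0; have d20 : 0 <= 2^-1 * delta ^+ 2 by rewrite mulr_ge0 ?sqr_ge0 ?invr_ge0.
  rewrite (powRM _ d20) ?powR_ge0 // -(powRrM m).
  have -> : m * m `^ (2 * nu) = m `^ (2 * nu + 1).
    have a0 : 0 < 2 * nu + 1 by rewrite addr_gt0 // mulr_gt0.
    by rewrite -(mulr_powRB1 (ltW m0) a0) addrK.
  rewrite -powR12_sqrt ?powR_ge0 // -powRrM; congr (_ <= _ * _ `^ _).
  by rewrite pE; field; rewrite gt_eqF.
split.
- move=> [x /OmegaP[w [wA wd xw]]].
  have [mu_lt0|mu_gt0|mu00] := ltgtP mu 0; last by rewrite mu00 eqxx in hmu0.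
    right; split => //; have -> : p = (2 * mu + 1) / mu by rewrite /p; field.
    by rewrite pmulr_rlt0 // invr_lt0.
  left; split.
    by have : 0 < mu^-1 by [rewrite invr_gt0]; rewrite /p; lra.
  have [|z _ zE] := op_power_range hA nu0 (_ : 1 / 2 < nu) w.
    by rewrite /nu; lra.
  exists (x - z) => u; rewrite /f !(least_squares_split A) linearB xw zE /=.
  rewrite addrK subrr normr0 expr0n mulr0 add0r.
  by rewrite lerDr mulr_ge0 // sqr_ge0.
- split; first by rewrite mulr_gt0 // powR_gt0.
  move=> x [/OmegaP[w [wA wd xw]] _].
  have [gap grad] := op_power_gap hA xw.
  rewrite gap grad cE; apply: (op_power_lojasiewicz hA nu0 pE hdelta wd).
  have -> : op_power (A \o adjoint A) nu w = -1 *: yd + A x.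
    by rewrite xw scaleN1r addrA addNr add0r.
  apply: closure_rangeP; first exact: data_proj_range.
  by apply: subset_closure; exists x.
- move=> [x0 /nonmin[w0 [w0A w0R Sw0]]] c' loj.
  have c'0 := loj.1.
  have ineq := source_inequality_closure hA nu0 w0A w0R (loj_source c' p loj).
  have gramR v : range A (gram hA v) by exists (adjoint A v).
  have gramN0 : exists v, gram hA v != 0.
    apply: contrapT => T0; move/eqP : Sw0; apply.
    have Tw0 : gram hA w0 = 0.
      by apply: contrapT => h; apply: T0; exists w0; apply/eqP.
    have -> : w0 = 0.
      apply: (closure_range_adjoint_eq0 hA) => //; apply/eqP.
      by rewrite -normr_eq0 -sqrf_eq0 -inner_norm -inner_gram Tw0 inner0l.
    have := op_approx_linear (op_power_approx hA nu0) (-1) 0 0.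
    by rewrite scaler0 addr0 scaleN1r addNr.
  have [m [/andP[m0 _]]] := @inequality_at_spectral_edge _ _ _ _ hA _ nu0 (gram hA) delta
    th c' (opnorm (gram hA)) ineq hdelta (ltW th0) c'0 (fun=> erefl) gramR gramN0
    (lexx _) (fun v => inner_le_opnorm (gram_bounded hA) _).
  rewrite edge_inequalityE // => h.
  have {}h : (2^-1 * delta ^+ 2) `^ th <= c' * delta.
    by rewrite -(ler_pM2r (powR_gt0 (2 * nu * th) m0)).
  rewrite cE -(ler_pM2r hdelta); apply: le_trans h.
  rewrite powRM ?sqr_ge0 ?invr_ge0 //.
  have -> : (2^-1 : R) `^ th = 2 `^ (- th) by rewrite -powR_inv1 // -powRrM mulN1r.
  rewrite -mulrA ler_wpM2l ?powR_ge0 //.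
  rewrite -powR_mulrn ?(ltW hdelta) // -powRrM.
  have -> : 2 * th = 1 / (2 * nu) + 1 by rewrite pE; field; rewrite gt_eqF.
  by rewrite powRD ?(gt_eqF hdelta) ?implybT // powRr1 // ltW.
move=> [x0 /nonmin[w0 [w0A w0R Sw0]]] nclosed p' [exp_p' [c' loj]].
have c'0 := loj.1.
have th'0 : 0 <= 1 - p'^-1.
  case: exp_p' => [[p1 _]|[p0 _]].
    by rewrite subr_ge0 invf_le1 // (lt_le_trans ltr01).
  by rewrite subr_ge0 (le_trans (ltW (_ : p'^-1 < 0))) // invr_lt0.
have ineq := source_inequality_closure hA nu0 w0A w0R (loj_source c' p' loj).
set th' := 1 - p'^-1 in th'0 ineq *.
rewrite leNgt; apply/negP => thth'.
have q0 : 0 < 2 * nu * (th - th') by rewrite !mulr_gt0 // subr_gt0.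
pose K := (2^-1 * delta ^+ 2) `^ th' / (c' * delta).
have K0 : 0 < K.
  by rewrite divr_gt0 ?powR_gt0 ?mulr_gt0 ?invr_gt0 ?exprn_gt0.
(* for m <= e the exponents th' and th give the bounds K and K / 2 *)
pose e := (K / 2) `^ (2 * nu * (th - th'))^-1.
have e0 : 0 < e by rewrite powR_gt0 // divr_gt0.
have [Q [TQ QA QN0 Qe]] := small_spectrum hA e0 nclosed.
have Qe' v : inner (gram hA (Q v)) (Q v) <=
    Num.min e (opnorm (gram hA)) * `|Q v| ^+ 2.
  rewrite minr_pMl ?sqr_ge0 // le_min Qe /=.
  exact: (inner_le_opnorm (gram_bounded hA)).
have eM : Num.min e (opnorm (gram hA)) <= opnorm (gram hA).
  by rewrite ge_min lexx orbT.
have [m [/andP[m0 me]]] := @inequality_at_spectral_edge _ _ _ _ hA _ nu0 Q delta th' c' _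
  ineq hdelta th'0 c'0 TQ QA QN0 eM Qe'.
rewrite edge_inequalityE // => h.
have Km : K <= m `^ (2 * nu * (th - th')).
  rewrite ler_pdivrMr ?mulr_gt0 // -(ler_pM2r (powR_gt0 (2 * nu * th') m0)).
  rewrite [leRHS]mulrAC -powRD ?(gt_eqF m0) ?implybT //.
  by rewrite -mulrDr subrK [leRHS]mulrC.
have : m `^ (2 * nu * (th - th')) <= K / 2.
  have -> : K / 2 = e `^ (2 * nu * (th - th')).
    by rewrite /e -powRrM mulVf ?(gt_eqF q0) // powRr1 // ltW // divr_gt0.
  apply: ge0_ler_powR; rewrite ?nnegrE ?(ltW q0) ?(ltW m0) ?(ltW e0) //.
  by apply: le_trans me _; rewrite ge_min lexx.
by lra.
Qed.
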